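(* Let $(X,|\cdot|)$ be a compact metric space, let $B\subset X^2\setminus\Delta$ satisfy (a) $(y,y')\in B\Leftrightarrow(y',y)\in B$ and (b) $B_t=\{(y,y')\in B:|yy'|\ge t\}$ is finite for each $t>0$, and let $m:B\to\mathbb N$ be a symmetric function, $m(y,y')=m(y',y)$. Then the spectral triple $M(B,m)=\{\mathcal A,\mathcal H,ds\}$ is a spectral geometry on $X$.
   Context: $|xy|$ denotes the distance in $X$, $\Delta\subset X^2=X\times X$ the diagonal. The triple $M(B,m)$: $\mathcal H$ consists of functions $\xi$ on $B$ with $\xi(y,y')\in\mathbb C^{m(y,y')}$ and $\sum_{(y,y')\in B}\|\xi(y,y')\|^2<\infty$; $\mathcal A$ is the algebra of complex-valued Lipschitz functions on $X$, acting by $(\pi(a)\xi)(y,y')=a(y)\xi(y,y')$; and $(ds\,\xi)(y,y')=|yy'|\,\xi(y',y)$. Spectral measure: a function $P$ on Borel subsets of $X^2$ with values in orthogonal projectors of a Hilbert space $\mathcal H$ such that $A\mapsto (P(A)\xi,\xi)$ is a Borel measure for every $\xi\in\mathcal H$. Spectral geometry on $X$: an involutive representation $\pi$ of the algebra $\mathcal A$ of Lipschitz functions on $X$ in a Hilbert space $\mathcal H$, and an injective compact self-adjoint operator $ds$ on $\mathcal H$, such that: (i) $\pi$ is the restriction to $\mathcal A$ of an involutive representation $\widetilde\pi$ of the $C^*$-algebra of continuous functions on $X^2$, where $a\in\mathcal A$ is considered as the function $(x,x')\mapsto a(x)$ on $X^2$. Representations are unital. Let $P$ be the spectral measure on $X^2$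 with $\widetilde\pi(a)=\int_{X^2}a\,dP$ for all continuous $a$. (ii) $ds\circ P(A)=P(\gamma(A))\circ ds$ for every Borel $A\subset X^2$, where $\gamma(x,x')=(x',x)$. For an eigenvalue $\lambda$ of $ds$ let $L_\lambda$ be the eigenspace of $ds^2$ for the eigenvalue $\lambda^2$, and let $A_\lambda$ be the union of all open $A\subset X^2$ for which $P(A)$ projects onto a subspace orthogonal to $L_\lambda$. (iii) $P(A_\lambda)$ is the projector onto the orthogonal complement $L_\lambda^\perp$ for each eigenvalue $\lambda$ of $ds$. Put $\Lambda_\lambda=X^2\setminus A_\lambda$. (iv) $|yy'|=|\lambda|$ for every $(y,y')\in\Lambda_\lambda$ and every eigenvalue $\lambda$ of $ds$. *)

(* Defs.v *)
From HB Require Import structures.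
From mathcomp Require Import all_boot all_order all_algebra.
From mathcomp Require Import all_classical all_reals all_analysis.
From mathcomp Require Import complex ring lra.
Set Implicit Arguments.
Unset Strict Implicit.
Unset Printing Implicit Defensive.
Import Order.TTheory GRing.Theory Num.Theory.
Import numFieldNormedType.Exports.
Local Open Scope classical_set_scope.
Local Open Scope ring_scope.
Local Open Scope complex_scope.

(* R[i] has no canonical topology in the library; this gives it the one of its
   modulus. *)
HB.instance Definition _ (R : realType) := NormedModule.copy R[i] R[i]^o.

HB.mixin Record NormedModule_isHilbert (R : realType) H
    & CompleteNormedModule R[i] H := {
  inner : H -> H -> R[i] ;
  innerDl : forall x y z, inner (x + y) z = inner x z + inner y z ;
  innerZl : forall c x y, inner (c *: x) y = c * inner x y ;
  innerC : forall x y, inner y x = (inner x y)^* ;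
  inner_norm : forall x, inner x x = `|x| ^+ 2
}.

#[short(type="hilbertType")]
HB.structure Definition Hilbert (R : realType) :=
  {H of NormedModule_isHilbert R H & CompleteNormedModule R[i] H}.

Section unordered_sums.
Variables (R : realType) (I : choiceType).
Implicit Types (f g p q : I -> R) (u v : I -> R[i]).

(* Sums over an arbitrary index type: \esum handles nonnegative families, so an
   absolutely summable real family is summed as positive minus negative part,
   and a complex one componentwise. *)
Definition asummable f : Prop :=
  (\esum_(k in [set: I]) `|f k|%:E < +oo)%E.

Definition rsum f : R :=
  fine (\esum_(k in [set: I]) (Num.max (f k) 0)%:E)%E
  - fine (\esum_(k in [set: I]) (Num.max (- f k) 0)%:E)%E.

Definition csummable u : Prop :=
  asummable (fun k => complex.Re (u k)) /\ asummable (fun k => complex.Im (u k)).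

Definition csum u : R[i] :=
  rsum (fun k => complex.Re (u k)) +i* rsum (fun k => complex.Im (u k)).

Lemma asummable_le f g : (forall k, `|f k| <= g k) ->
  asummable g -> asummable f.
Proof.
move=> fg; apply: le_lt_trans; apply: le_esum => k _.
by rewrite lee_fin (le_trans (fg k))// ler_norm.
Qed.

Lemma asummable_ge0 f : (forall k, 0 <= f k) ->
  asummable f = (\esum_(k in [set: I]) (f k)%:E < +oo)%E.
Proof.
move=> f0; rewrite /asummable; congr (is_true (_ < _)%E).
by apply: eq_esum => k _; rewrite ger0_norm.
Qed.

Lemma esum_fin f : (forall k, 0 <= f k) -> asummable f ->
  (\esum_(k in [set: I]) (f k)%:E)%E \is a fin_num.
Proof.
move=> f0; rewrite asummable_ge0// => fs; rewrite ge0_fin_numE//.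
by apply: esum_ge0 => k _; rewrite lee_fin.
Qed.

Lemma asummableD f g : asummable f -> asummable g ->
  asummable (fun k => f k + g k).
Proof.
move=> fs gs; apply: le_lt_trans (lte_add_pinfty fs gs).
rewrite -esumD; [|by move=> k _; rewrite lee_fin ..].
by apply: le_esum => k _; rewrite -EFinD lee_fin ler_normD.
Qed.

Lemma esumZ (c : R) f : 0 <= c -> (forall k, 0 <= f k) ->
  (\esum_(k in [set: I]) (c * f k)%:E = c%:E * \esum_(k in [set: I]) (f k)%:E)%E.
Proof.
have H (d : R) g : 0 <= d -> (forall k, 0 <= g k) ->
    (\esum_(k in [set: I]) (d * g k)%:E <= d%:E * \esum_(k in [set: I]) (g k)%:E)%E.
  move=> d0 g0; apply: ge_ereal_sup => _ [F [finF _]] <-.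
  have <- : (d%:E * (\sum_(k \in F) (g k)%:E) = \sum_(k \in F) (d * g k)%:E)%E.
    rewrite ge0_mule_fsumr; last by move=> k; rewrite lee_fin.
    by apply: eq_fsbigr => k _; rewrite EFinM.
  rewrite lee_wpmul2l ?lee_fin//.
  by apply: ereal_sup_ubound; exists F.
rewrite le_eqVlt => /predU1P[<- f0|c0 f0].
  by rewrite mul0e esum1// => k _; rewrite mul0r.
apply/eqP; rewrite eq_le (H _ _ (ltW c0) f0)/=.
rewrite -lee_pdivlMl//.
apply: le_trans (H c^-1 (fun k => c * f k) _ _); last first.
- by move=> k; rewrite mulr_ge0 ?(ltW c0).
- by rewrite invr_ge0 (ltW c0).
by apply: le_esum => k _; rewrite mulKf ?gt_eqF.
Qed.

Lemma asummableZ (c : R) f : asummable f -> asummable (fun k => c * f k).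
Proof.
move=> fs; rewrite /asummable.
under eq_esum do rewrite normrM.
by rewrite esumZ// lte_mul_pinfty// lee_fin.
Qed.

Lemma asummableN f : asummable f -> asummable (fun k => - f k).
Proof.
move=> fs; rewrite /asummable.
by under eq_esum do rewrite normrN.
Qed.

Lemma asummable_max f : asummable f -> asummable (fun k => Num.max (f k) 0).
Proof.
apply: le_lt_trans; apply: le_esum => k _; rewrite lee_fin.
by case: (leP (f k) 0) => fk; rewrite ?normr0.
Qed.

Lemma max0_ge0 (x : R) : 0 <= Num.max x 0.
Proof. by rewrite le_max lexx orbT. Qed.

Lemma rsumB p q : (forall k, 0 <= p k) -> (forall k, 0 <= q k) ->
  asummable p -> asummable q ->
  rsum (fun k => p k - q k) = fine (\esum_(k in [set: I]) (p k)%:E)%E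
                              - fine (\esum_(k in [set: I]) (q k)%:E)%E.
Proof.
move=> p0 q0 ps qs.
have pq : asummable (fun k => p k - q k) by apply/asummableD/asummableN.
have := @esumB R I [set: I] (EFin \o p) (EFin \o q) ps qs
  (fun k _ => p0 k) (fun k _ => q0 k).
rewrite (eq_esum (b := fun k => (Num.max (p k - q k) 0)%:E)); last first.
  by move=> k _; rewrite funeposE EFin_max.
rewrite [X in (_ - X)%E = _](eq_esum
    (b := fun k => (Num.max (- (p k - q k)) 0)%:E)); last first.
  by move=> k _; rewrite funenegE EFin_max.
have fin f : asummable f ->
    (\esum_(k in [set: I]) (Num.max (f k) 0)%:E)%E \is a fin_num.
  by move=> fs; apply: esum_fin => [k|]; [exact: max0_ge0|exact: asummable_max].
move=> /(congr1 fine).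
by rewrite (fineB (fin _ pq) (fin _ (asummableN pq))) fineB ?esum_fin.
Qed.

Lemma rsumN f : rsum (fun k => - f k) = - rsum f.
Proof.
rewrite /rsum opprB; congr (_ - _); congr fine.
by apply: eq_esum => k _; rewrite opprK.
Qed.

Lemma rsum_ge0E f : (forall k, 0 <= f k) ->
  rsum f = fine (\esum_(k in [set: I]) (f k)%:E)%E.
Proof.
move=> f0; rewrite /rsum [X in _ - fine X]esum1 ?subr0; last first.
  by move=> k _; rewrite max_r// oppr_le0.
by congr fine; apply: eq_esum => k _; rewrite max_l.
Qed.

Lemma max0B (x : R) : x = Num.max x 0 - Num.max (- x) 0.
Proof.
by case: (leP x 0) => x0; [rewrite max_l ?oppr_ge0// sub0r opprK|
  rewrite max_r ?subr0// oppr_le0 ltW].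
Qed.

Lemma rsumD f g : asummable f -> asummable g ->
  rsum (fun k => f k + g k) = rsum f + rsum g.
Proof.
move=> fs gs.
have -> : (fun k => f k + g k) =
    (fun k => (Num.max (f k) 0 + Num.max (g k) 0)
              - (Num.max (- f k) 0 + Num.max (- g k) 0)).
  by apply/funext => k; rewrite {1}(max0B (f k)) {1}(max0B (g k)) addrACA opprD.
have s1 := asummable_max fs; have s2 := asummable_max gs.
have s3 := asummable_max (asummableN fs).
have s4 := asummable_max (asummableN gs).
have fin h : asummable h ->
    (\esum_(k in [set: I]) (Num.max (h k) 0)%:E)%E \is a fin_num.
  by move=> hs; apply: esum_fin => [k|]; [exact: max0_ge0|exact: asummable_max].
rewrite rsumB; last 4 first.
- by move=> k; rewrite addr_ge0 ?max0_ge0.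
- by move=> k; rewrite addr_ge0 ?max0_ge0.
- exact: asummableD.
- exact: asummableD.
under eq_esum do rewrite EFinD.
under [in X in _ - fine X]eq_esum do rewrite EFinD.
rewrite !esumD; try by move=> k _; rewrite lee_fin max0_ge0.
rewrite (fineD (fin _ fs) (fin _ gs)).
rewrite (fineD (fin _ (asummableN fs)) (fin _ (asummableN gs))).
by rewrite /rsum opprD addrACA.
Qed.

Lemma eq_rsum f g : f =1 g -> rsum f = rsum g.
Proof. by move=> /funext ->. Qed.

Lemma eq_asummable f g : f =1 g -> asummable g -> asummable f.
Proof. by move=> /funext ->. Qed.

Lemma rsumZ (c : R) f : asummable f ->
  rsum (fun k => c * f k) = c * rsum f.
Proof.
have H d g : 0 <= d -> asummable g -> rsum (fun k => d * g k) = d * rsum g.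
  move=> d0 gs.
  have K h : asummable h ->
      fine (\esum_(k in [set: I]) (Num.max (d * h k) 0)%:E)%E =
      d * fine (\esum_(k in [set: I]) (Num.max (h k) 0)%:E)%E.
    move=> hs; rewrite (eq_esum (b := fun k => (d * Num.max (h k) 0)%:E)).
      rewrite (esumZ d0 (fun k => max0_ge0 (h k))) fineM//.
      by apply: esum_fin (asummable_max hs) => k; exact: max0_ge0.
    by move=> k _; rewrite maxr_pMr// mulr0.
  rewrite /rsum K// mulrBr; congr (_ - _).
  under eq_esum do rewrite -mulrN.
  exact/K/asummableN.
move=> fs; have [c0|c0] := leP 0 c; first exact: H.
rewrite (eq_rsum (g := fun k => - (- c * f k))) => [|k].
  by rewrite rsumN H ?oppr_ge0 ?ltW// mulNr opprK.
by rewrite mulNr opprK.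
Qed.

Lemma csummableD u v : csummable u -> csummable v ->
  csummable (fun k => u k + v k).
Proof.
move=> [u1 u2] [v1 v2]; split.
  by apply: eq_asummable (asummableD u1 v1) => k; rewrite raddfD.
by apply: eq_asummable (asummableD u2 v2) => k; rewrite raddfD.
Qed.

Lemma csumD u v : csummable u -> csummable v ->
  csum (fun k => u k + v k) = csum u + csum v.
Proof.
move=> [u1 u2] [v1 v2]; rewrite /csum.
rewrite (eq_rsum (fun k => raddfD (@complex.Re R) (u k) (v k))).
rewrite [X in _ +i* X](eq_rsum (fun k => raddfD (@complex.Im R) (u k) (v k))).
by rewrite !rsumD.
Qed.

Lemma ReM (x y : R[i]) : complex.Re (x * y) =
  complex.Re x * complex.Re y - complex.Im x * complex.Im y.
Proof. by case: x => a b; case: y. Qed.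

Lemma ImM (x y : R[i]) : complex.Im (x * y) =
  complex.Re x * complex.Im y + complex.Im x * complex.Re y.
Proof. by case: x => a b; case: y. Qed.

Lemma csumZ (c : R[i]) u : csummable u ->
  csum (fun k => c * u k) = c * csum u.
Proof.
move=> [u1 u2]; rewrite /csum.
rewrite (eq_rsum (fun k => ReM c (u k))).
rewrite [X in _ +i* X](eq_rsum (fun k => ImM c (u k))).
rewrite rsumD ?rsumN ?rsumD ?rsumZ//; try exact: asummableZ.
  by case: c => a b.
by apply/asummableN/asummableZ.
Qed.

Lemma csumJ u : csum (fun k => (u k)^*) = (csum u)^*.
Proof.
rewrite /csum/= -rsumN; congr (_ +i* _); congr rsum; apply/funext => k;
  by case: (u k).
Qed.

End unordered_sums.

Section rows.
Variables (R : realType) (n : nat).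
Implicit Types u v w : 'rV[R[i]]_n.

Definition row_dot u v : R[i] := \sum_(j < n) u 0 j * (v 0 j)^*.

(* Squared Hermitian norm on C^n; the library norm of a row vector is the sup
   norm and is not used here. *)
Definition row_sqnorm u : R :=
  \sum_(j < n) (complex.Re (u 0 j) ^+ 2 + complex.Im (u 0 j) ^+ 2).

Lemma row_sqnorm_ge0 u : 0 <= row_sqnorm u.
Proof. by apply: sumr_ge0 => j _; rewrite addr_ge0 ?sqr_ge0. Qed.

Lemma row_dotxx u : row_dot u u = (row_sqnorm u)%:C.
Proof.
rewrite /row_dot /row_sqnorm rmorph_sum; apply: eq_bigr => j _.
by case: (u 0 j) => a b; apply/eqP; rewrite eq_complex/=; apply/andP; split;
  apply/eqP; ring.
Qed.

Lemma row_dotDl u v w : row_dot (u + v) w = row_dot u w + row_dot v w.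
Proof.
by rewrite /row_dot -big_split; apply: eq_bigr => j _; rewrite mxE mulrDl.
Qed.

Lemma row_dotZl c u v : row_dot (c *: u) v = c * row_dot u v.
Proof.
by rewrite /row_dot mulr_sumr; apply: eq_bigr => j _; rewrite mxE mulrA.
Qed.

Lemma row_dotC u v : row_dot v u = (row_dot u v)^*.
Proof.
rewrite /row_dot rmorph_sum; apply: eq_bigr => j _.
by rewrite rmorphM/= conjcK mulrC.
Qed.

Lemma norm_dot2_le (a b c d : R) :
  `|a * c + b * d| <= a ^+ 2 + b ^+ 2 + (c ^+ 2 + d ^+ 2).
Proof.
have := sqr_ge0 (a + c); have := sqr_ge0 (a - c).
have := sqr_ge0 (b + d); have := sqr_ge0 (b - d).
have := sqr_ge0 a; have := sqr_ge0 b; have := sqr_ge0 c; have := sqr_ge0 d.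
by rewrite ler_norml !sqrrD !sqrrN !mulrN !mulr2n => *; apply/andP; split; lra.
Qed.

Lemma row_dot_Re u v : `|complex.Re (row_dot u v)| <= row_sqnorm u + row_sqnorm v.
Proof.
rewrite /row_dot /row_sqnorm raddf_sum -big_split/=.
apply: (le_trans (ler_norm_sum _ _ _)); apply: ler_sum => j _.
case: (u 0 j) => a b; case: (v 0 j) => c d /=; by have := norm_dot2_le a b c d; congr (`|_| <= _); ring.
Qed.

Lemma row_dot_Im u v : `|complex.Im (row_dot u v)| <= row_sqnorm u + row_sqnorm v.
Proof.
rewrite /row_dot /row_sqnorm raddf_sum -big_split/=.
apply: (le_trans (ler_norm_sum _ _ _)); apply: ler_sum => j _.
case: (u 0 j) => a b; case: (v 0 j) => c d /=; have := norm_dot2_le b a c (- d).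
by rewrite sqrrN [b ^+ 2 + _]addrC; congr (`|_| <= _); ring.
Qed.

Lemma row_sqnormD u v : row_sqnorm (u + v) <= 2 * row_sqnorm u + 2 * row_sqnorm v.
Proof.
rewrite /row_sqnorm !mulr_sumr -big_split/=; apply: ler_sum => j _; rewrite mxE.
case: (u 0 j) => a b; case: (v 0 j) => c d /=.
have := sqr_ge0 (a - c); have := sqr_ge0 (b - d).
by rewrite !sqrrD !sqrrN !mulrN !mulr2n; lra.
Qed.

Lemma row_sqnormZ (c : R[i]) u : row_sqnorm (c *: u) =
  (complex.Re c ^+ 2 + complex.Im c ^+ 2) * row_sqnorm u.
Proof.
rewrite /row_sqnorm mulr_sumr; apply: eq_bigr => j _; rewrite mxE.
by case: c => a b; case: (u 0 j) => x y /=; ring.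
Qed.

Lemma row_sqnorm_eq0 u : row_sqnorm u = 0 -> u = 0.
Proof.
move=> /eqP; rewrite psumr_eq0 => [/allP h|j _]; last by rewrite addr_ge0 ?sqr_ge0.
apply/rowP => j; rewrite mxE.
have := h j (mem_index_enum j); rewrite paddr_eq0 ?sqr_ge0// !sqrf_eq0.
by case: (u 0 j) => a b /= /andP[/eqP -> /eqP ->].
Qed.

End rows.

Section l2.
Variables (R : realType) (I : choiceType) (n : I -> nat).

Definition sqsummable (f : forall k, 'rV[R[i]]_(n k)) : Prop :=
  (\esum_(k in [set: I]) (row_sqnorm (f k))%:E < +oo)%E.

(* The Hilbert sum of the spaces C^(n k), k : I. *)
Record l2 := L2 {
  l2_fun :> forall k, 'rV[R[i]]_(n k) ;
  l2P : sqsummable l2_fun }.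

HB.instance Definition _ := gen_eqMixin l2.
HB.instance Definition _ := gen_choiceMixin l2.

Lemma l2_ext (x y : l2) : (forall k, x k = y k) -> x = y.
Proof.
case: x y => [f fP] [g gP] /= fg.
have {}fg : f = g by exact: functional_extensionality_dep.
by subst g; congr L2; exact: Prop_irrelevance.
Qed.

Lemma sqsummableE f :
  sqsummable f = asummable (fun k => row_sqnorm (f k)).
Proof. by rewrite asummable_ge0// => k; exact: row_sqnorm_ge0. Qed.

Lemma sqsummable0 : sqsummable (fun=> 0).
Proof.
rewrite /sqsummable esum1// => k _; rewrite /row_sqnorm big1// => j _.
by rewrite mxE/= expr0n addr0.
Qed.

Lemma sqsummableD f g : sqsummable f -> sqsummable g ->
  sqsummable (fun k => f k + g k).
Proof.
rewrite !sqsummableE => fs gs.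
apply: asummable_le (asummableD (asummableZ 2 fs) (asummableZ 2 gs)) => k.
by rewrite ger0_norm ?row_sqnorm_ge0// row_sqnormD.
Qed.

Lemma sqsummableZ c f : sqsummable f -> sqsummable (fun k => c *: f k).
Proof.
rewrite !sqsummableE; under [X in _ -> asummable X]funext do rewrite row_sqnormZ.
exact: asummableZ.
Qed.

Definition l2_zero := L2 sqsummable0.
Definition l2_add (x y : l2) := L2 (sqsummableD (l2P x) (l2P y)).
Definition l2_scale c (x : l2) := L2 (sqsummableZ c (l2P x)).
Definition l2_opp x := l2_scale (-1) x.

Lemma l2_addA : associative l2_add.
Proof. by move=> x y z; apply: l2_ext => k /=; rewrite addrA. Qed.

Lemma l2_addC : commutative l2_add.
Proof. by move=> x y; apply: l2_ext => k /=; rewrite addrC. Qed.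

Lemma l2_add0 : left_id l2_zero l2_add.
Proof. by move=> x; apply: l2_ext => k /=; rewrite add0r. Qed.

Lemma l2_addN : left_inverse l2_zero l2_opp l2_add.
Proof. by move=> x; apply: l2_ext => k /=; rewrite scaleN1r addNr. Qed.

HB.instance Definition _ :=
  GRing.isZmodule.Build l2 l2_addA l2_addC l2_add0 l2_addN.

Lemma l2_scaleA a b x : l2_scale a (l2_scale b x) = l2_scale (a * b) x.
Proof. by apply: l2_ext => k /=; rewrite scalerA. Qed.

Lemma l2_scale1 : left_id 1 l2_scale.
Proof. by move=> x; apply: l2_ext => k /=; rewrite scale1r. Qed.

Lemma l2_scaleDr : right_distributive l2_scale +%R.
Proof. by move=> c x y; apply: l2_ext => k /=; rewrite scalerDr. Qed.

Lemma l2_scaleDl x : {morph l2_scale^~ x : a b / a + b}.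
Proof. by move=> a b; apply: l2_ext => k /=; rewrite scalerDl. Qed.

HB.instance Definition _ := GRing.Zmodule_isLmodule.Build R[i] l2
  l2_scaleA l2_scale1 l2_scaleDr l2_scaleDl.

Lemma l2DE (x y : l2) k : (x + y) k = x k + y k.
Proof. by []. Qed.

Lemma l2ZE c (x : l2) k : (c *: x) k = c *: x k.
Proof. by []. Qed.

Lemma l2NE (x : l2) k : (- x) k = - x k.
Proof. by rewrite -scaleN1r l2ZE scaleN1r. Qed.

Definition l2_inner (x y : l2) : R[i] := csum (fun k => row_dot (x k) (y k)).

Definition l2_sqnorm (x : l2) : R :=
  fine (\esum_(k in [set: I]) (row_sqnorm (x k))%:E)%E.

Definition l2_norm (x : l2) : R[i] := (Num.sqrt (l2_sqnorm x))%:C.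

Lemma l2_csummable (x y : l2) : csummable (fun k => row_dot (x k) (y k)).
Proof.
have xy : asummable (fun k => row_sqnorm (x k) + row_sqnorm (y k)).
  by apply: asummableD; rewrite -sqsummableE; exact: l2P.
split; [apply: asummable_le xy => k; exact: row_dot_Re|
        apply: asummable_le xy => k; exact: row_dot_Im].
Qed.

Lemma l2_innerDl x y z : l2_inner (x + y) z = l2_inner x z + l2_inner y z.
Proof.
rewrite -csumD; try exact: l2_csummable.
by congr csum; apply/funext => k; rewrite l2DE row_dotDl.
Qed.

Lemma l2_innerZl c x y : l2_inner (c *: x) y = c * l2_inner x y.
Proof.
rewrite -csumZ; last exact: l2_csummable.
by congr csum; apply/funext => k; rewrite l2ZE row_dotZl.
Qed.

Lemma l2_innerC x y : l2_inner y x = (l2_inner x y)^*.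
Proof. by rewrite -csumJ; congr csum; apply/funext => k; rewrite row_dotC. Qed.

Lemma l2_innerxx x : l2_inner x x = (l2_sqnorm x)%:C.
Proof.
rewrite /l2_inner /csum; congr (_ +i* _).
  rewrite (eq_rsum (g := fun k => row_sqnorm (x k))) => [|k]; last first.
    by rewrite row_dotxx.
  by rewrite rsum_ge0E// => k; exact: row_sqnorm_ge0.
rewrite (eq_rsum (g := fun k => 0)) => [|k]; last by rewrite row_dotxx.
by rewrite rsum_ge0E// esum1.
Qed.

Lemma l2_sqnorm_fin (x : l2) :
  (\esum_(k in [set: I]) (row_sqnorm (x k))%:E)%E \is a fin_num.
Proof.
apply: esum_fin => [k|]; first exact: row_sqnorm_ge0.
by rewrite -sqsummableE; exact: l2P.
Qed.

Lemma l2_sqnorm_ge0 x : 0 <= l2_sqnorm x.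
Proof. by apply/fine_ge0/esum_ge0 => k _; rewrite lee_fin row_sqnorm_ge0. Qed.

Lemma l2_sqnorm_ge (x : l2) k : row_sqnorm (x k) <= l2_sqnorm x.
Proof.
rewrite -lee_fin fineK ?l2_sqnorm_fin//; apply: esum_ge.
by exists [set k]; rewrite ?fsbig_set1.
Qed.

Lemma l2_innerxx_norm x : l2_inner x x = l2_norm x ^+ 2.
Proof. by rewrite l2_innerxx /l2_norm -rmorphXn/= sqr_sqrtr ?l2_sqnorm_ge0. Qed.

Lemma l2_sqnorm_eq0 x : l2_sqnorm x = 0 -> x = 0.
Proof.
move=> x0; apply: l2_ext => k; apply: row_sqnorm_eq0; apply/eqP.
by rewrite eq_le row_sqnorm_ge0 andbT -x0 l2_sqnorm_ge.
Qed.

Lemma l2_norm0_eq0 x : l2_norm x = 0 -> x = 0.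
Proof.
move=> /complexI /eqP; rewrite sqrtr_eq0 => x0; apply: l2_sqnorm_eq0.
by apply/eqP; rewrite eq_le x0 l2_sqnorm_ge0.
Qed.

Lemma l2_sqnormZ c x : l2_sqnorm (c *: x) =
  (complex.Re c ^+ 2 + complex.Im c ^+ 2) * l2_sqnorm x.
Proof.
apply: complexI; rewrite -l2_innerxx l2_innerZl l2_innerC l2_innerZl l2_innerxx.
case: c => a b; apply/eqP; rewrite eq_complex/=; apply/andP; split;
  by apply/eqP; ring.
Qed.

Lemma l2_normZ c x : l2_norm (c *: x) = `|c| * l2_norm x.
Proof.
rewrite /l2_norm normc_def l2_sqnormZ sqrtrM ?rmorphM//.
by rewrite addr_ge0 ?sqr_ge0.
Qed.

Lemma l2_sqnormD x y : l2_sqnorm (x + y) =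
  l2_sqnorm x + l2_sqnorm y + 2 * complex.Re (l2_inner x y).
Proof.
have -> : forall z, l2_sqnorm z = complex.Re (l2_inner z z).
  by move=> z; rewrite l2_innerxx.
rewrite l2_innerDl (l2_innerC (x + y) x) (l2_innerC (x + y) y) !l2_innerDl.
rewrite (l2_innerC x y) (l2_innerxx x) (l2_innerxx y).
by case: (l2_inner x y) => a b /=; ring.
Qed.

Lemma l2_Re_inner_le x y :
  complex.Re (l2_inner x y) <= Num.sqrt (l2_sqnorm x) * Num.sqrt (l2_sqnorm y).
Proof.
set B := complex.Re _.
have H (t : R) : 0 <= l2_sqnorm y + t ^+ 2 * l2_sqnorm x + 2 * t * B.
  have := l2_sqnorm_ge0 (t%:C *: x + y).
  rewrite l2_sqnormD l2_innerZl l2_sqnormZ ReM /B.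
  by case: (l2_inner x y) => a b /=; congr (0 <= _); ring.
rewrite -sqrtrM ?l2_sqnorm_ge0//.
have [x0|x0] := eqVneq (l2_sqnorm x) 0.
  have -> : B = 0.
    by rewrite /B (l2_sqnorm_eq0 x0) -(scale0r 0) l2_innerZl mul0r.
  exact: sqrtr_ge0.
have {x0}x0 : 0 < l2_sqnorm x by rewrite lt_neqAle eq_sym x0 l2_sqnorm_ge0.
apply: le_trans (ler_norm _) _; rewrite -sqrtr_sqr ler_sqrt; last first.
  by rewrite mulr_ge0 ?l2_sqnorm_ge0.
have := H (- B / l2_sqnorm x).
have -> : l2_sqnorm y + (- B / l2_sqnorm x) ^+ 2 * l2_sqnorm x +
    2 * (- B / l2_sqnorm x) * B = l2_sqnorm y - B ^+ 2 / l2_sqnorm x.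
  by field; rewrite gt_eqF.
by rewrite subr_ge0 ler_pdivrMr// mulrC.
Qed.

Lemma l2_normD x y : l2_norm (x + y) <= l2_norm x + l2_norm y.
Proof.
rewrite -rmorphD lecR -[leRHS]ger0_norm ?addr_ge0 ?sqrtr_ge0//.
rewrite -[leRHS]sqrtr_sqr ler_sqrt ?sqr_ge0// l2_sqnormD sqrrD.
rewrite !sqr_sqrtr ?l2_sqnorm_ge0//.
by have := l2_Re_inner_le x y; lra.
Qed.

HB.instance Definition _ :=
  Lmodule_isNormed.Build R[i] l2 l2_normD l2_normZ l2_norm0_eq0.

Lemma l2_normE (x : l2) : `|x| = (Num.sqrt (l2_sqnorm x))%:C.
Proof. by []. Qed.

Lemma l2_ballE (x y : l2) (e : R) : 0 < e ->
  ball x e%:C y = (l2_sqnorm (x - y) < e ^+ 2) :> Prop.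
Proof.
move=> e0; rewrite -ball_normE /ball_/= l2_normE ltcR.
by rewrite -[in LHS](ger0_norm (ltW e0)) -sqrtr_sqr ltr_sqrt// exprn_gt0.
Qed.

Lemma cvg_rsum_seq (T : Type) (F : set_system T) (FF : Filter F)
    (J : Type) (r : seq J) (f : J -> T -> R) (l : J -> R) :
  (forall j, f j x @[x --> F] --> l j) ->
  (\sum_(j <- r) f j x) @[x --> F] --> \sum_(j <- r) l j.
Proof.
move=> fl; elim: r => [|j r IH].
  by rewrite big_nil; under eq_fun do rewrite big_nil; exact: cvg_cst.
by rewrite big_cons; under eq_fun do rewrite big_cons; exact: cvgD.
Qed.

Lemma l2_coord_le (x : l2) k j :
  `|complex.Re (x k 0 j)| <= Num.sqrt (l2_sqnorm x) /\
  `|complex.Im (x k 0 j)| <= Num.sqrt (l2_sqnorm x).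
Proof.
have H : complex.Re (x k 0 j) ^+ 2 + complex.Im (x k 0 j) ^+ 2 <= l2_sqnorm x.
  apply: le_trans (l2_sqnorm_ge x k); rewrite /row_sqnorm (bigD1 j)//=.
  by rewrite lerDl sumr_ge0// => i _; rewrite addr_ge0 ?sqr_ge0.
split; rewrite -sqrtr_sqr ler_sqrt ?l2_sqnorm_ge0//; apply: le_trans H.
  by rewrite lerDl sqr_ge0.
by rewrite lerDr sqr_ge0.
Qed.

Lemma l2_complete (F : set_system l2) : ProperFilter F -> cauchy F -> cvg F.
Proof.
move=> FF /cauchyP Fc.
have {}Fc (e : R) : 0 < e -> exists x, \forall y \near F, l2_sqnorm (x - y) < e ^+ 2.
  move=> e0; have [|x Fx] := Fc e%:C; first by rewrite ltcR.
  by exists x; apply: filterS Fx => y; rewrite l2_ballE.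
pose cRe k (j : 'I_(n k)) (x : l2) : R := complex.Re (x k 0 j).
have ccRe k j : cvg (cRe k j @ F).
  apply/cauchy_cvgP/cauchy_exP => e e0; have [x Fx] := Fc e e0.
  exists (cRe k j x); apply: filterS Fx => y xy.
  rewrite -ball_normE /ball_/= /cRe -raddfB.
  have := (l2_coord_le (x - y) j).1; rewrite l2DE l2NE !mxE.
  move=> h; apply: le_lt_trans h _.
  by rewrite -[ltRHS](ger0_norm (ltW e0)) -sqrtr_sqr ltr_sqrt ?exprn_gt0.
pose cIm k (j : 'I_(n k)) (x : l2) : R := complex.Im (x k 0 j).
have ccIm k j : cvg (cIm k j @ F).
  apply/cauchy_cvgP/cauchy_exP => e e0; have [x Fx] := Fc e e0.
  exists (cIm k j x); apply: filterS Fx => y xy.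
  rewrite -ball_normE /ball_/= /cIm -raddfB.
  have := (l2_coord_le (x - y) j).2; rewrite l2DE l2NE !mxE.
  move=> h; apply: le_lt_trans h _.
  by rewrite -[ltRHS](ger0_norm (ltW e0)) -sqrtr_sqr ltr_sqrt ?exprn_gt0.
pose z k : 'rV[R[i]]_(n k) := \row_j
  (lim (cRe k j @ F) +i* lim (cIm k j @ F)).
have key (e : R) (x : l2) : (\forall y \near F, l2_sqnorm (x - y) <= e) ->
    (\esum_(k in [set: I]) (row_sqnorm (x k - z k))%:E <= e%:E)%E.
  move=> Fx; apply: ge_ereal_sup => _ [S [finS _]] <-.
  rewrite fsbig_finite// sumEFin lee_fin.
  have xz : (\sum_(k <- finmap.enum_fset (fset_set S)) row_sqnorm (x k - (y : l2) k)) @[y --> F]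
      --> \sum_(k <- finmap.enum_fset (fset_set S)) row_sqnorm (x k - z k).
    apply: cvg_rsum_seq => k; apply: cvg_rsum_seq => j.
    have -> : (fun y : l2 => complex.Re ((x k - y k) 0 j) ^+ 2
        + complex.Im ((x k - y k) 0 j) ^+ 2) =
        (fun y => (cRe k j x - cRe k j y) * (cRe k j x - cRe k j y)
        + (cIm k j x - cIm k j y) * (cIm k j x - cIm k j y)).
      apply/funext => y; rewrite !mxE /cRe /cIm.
      by case: (x k 0 j) => a b; case: (y k 0 j) => c d; rewrite -!expr2.
    have -> : complex.Re ((x k - z k) 0 j) ^+ 2
        + complex.Im ((x k - z k) 0 j) ^+ 2 =
        (cRe k j x - lim (cRe k j @ F)) * (cRe k j x - lim (cRe k j @ F))
        + (cIm k j x - lim (cIm k j @ F)) * (cIm k j x - lim (cIm k j @ F)).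
      rewrite !mxE /cRe /cIm.
      by case: (x k 0 j) => a b; rewrite -!expr2.
    by apply: cvgD; apply: cvgM; apply: cvgB;
      [exact: cvg_cst|exact: ccRe|exact: cvg_cst|exact: ccRe
      |exact: cvg_cst|exact: ccIm|exact: cvg_cst|exact: ccIm].
  apply: (cvgr_to_le xz); apply: filterS Fx => y; apply: le_trans.
  rewrite -lee_fin -sumEFin -fsbig_finite// fineK ?l2_sqnorm_fin//.
  apply: esum_ge; exists S => //=.
  by apply: lee_fsum => // k _; rewrite scaleN1r.
have zs : sqsummable z.
  have [x Fx] := Fc 1 ltr01.
  have xz : sqsummable (fun k => x k - z k).
    apply: le_lt_trans (ltry (1 ^+ 2)); apply: key.
    by apply: filterS Fx => y /ltW.
  have := sqsummableD (l2P x) (sqsummableZ (-1) xz).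
  congr (sqsummable _); apply: functional_extensionality_dep => k.
  by rewrite scaleN1r opprB addrC subrK.
apply/cvg_ex; exists (L2 zs); apply/cvgrPdist_lt => e e0.
have [d d0 ->] : exists2 d : R, 0 < d & e = d%:C.
  have /complex_realP[d ed] : e \is Num.real by exact: gtr0_real.
  by exists d => //; rewrite -ltcR -ed.
have d2 : 0 < d / 3 by rewrite divr_gt0.
have [x Fx] := Fc _ d2.
have xz : `|x - L2 zs| <= (d / 3)%:C.
  rewrite l2_normE lecR -[leRHS](ger0_norm (ltW d2)) -sqrtr_sqr ler_sqrt ?sqr_ge0//.
  rewrite -lee_fin fineK ?l2_sqnorm_fin//.
  rewrite (eq_esum (b := fun k => (row_sqnorm (x k - z k))%:E)); last first.
    by move=> k _; rewrite l2DE l2NE.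
  by apply: key; apply: filterS Fx => y /ltW.
apply: filterS Fx => y; rewrite -l2_ballE// -ball_normE /ball_/= => xy.
rewrite -(subrKA x) (le_lt_trans (ler_normD _ _))// distrC.
apply: le_lt_trans (lerD xz (ltW xy)) _.
by rewrite -rmorphD ltcR; lra.
Qed.

HB.instance Definition _ := Uniform_isComplete.Build l2 l2_complete.

HB.instance Definition _ := NormedModule_isHilbert.Build R l2
  l2_innerDl l2_innerZl l2_innerC l2_innerxx_norm.

End l2.

Section operators.
Variables (R : realType) (H : hilbertType R).
Implicit Types (T P : H -> H) (V : set H) (lambda : R[i]).

Definition bounded_operator T : Prop := linear T /\ continuous T.

Definition self_adjoint T : Prop :=
  forall x y, inner (T x) y = inner x (T y).

Definition compact_operator T : Prop :=
  precompact (T @` [set x | `|x| <= 1]).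

Definition orthogonal_projector P : Prop :=
  [/\ bounded_operator P, self_adjoint P & forall x, P (P x) = P x].

Definition orthogonal_complement V : set H :=
  [set x | forall y, V y -> inner x y = 0].

Definition is_eigenvalue T lambda : Prop :=
  exists2 x, x != 0 & T x = lambda *: x.

Definition sq_eigenspace T lambda : set H :=
  [set x | T (T x) = lambda ^+ 2 *: x].

(* S is meant to be a unital algebra of complex functions closed under
   conjugation; the values of rep outside S are irrelevant. *)
Record star_representation (X : Type) (S : set (X -> R[i]))
    (rep : (X -> R[i]) -> H -> H) : Prop := StarRepresentation {
  rep_bounded : forall a, S a -> bounded_operator (rep a) ;
  rep_one : forall x, rep (fun=> 1) x = x ;
  rep_add : forall a b, S a -> S b ->
    forall x, rep (fun p => a p + b p) x = rep a x + rep b x ;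
  rep_scale : forall c a, S a ->
    forall x, rep (fun p => c * a p) x = c *: rep a x ;
  rep_mul : forall a b, S a -> S b ->
    forall x, rep (fun p => a p * b p) x = rep a (rep b x) ;
  rep_star : forall a, S a ->
    forall x y, inner (rep (fun p => (a p)^*) x) y = inner x (rep a y) }.

End operators.

(* Measurable types are pointed in the library, so the Borel space of T takes a
   base point as a parameter; the sigma-algebra does not depend on it. *)
Definition pointed_at (T : Type) (x0 : T) : Type := T.
HB.instance Definition _ (T : choiceType) (x0 : T) :=
  Choice.copy (pointed_at x0) T.
HB.instance Definition _ (T : choiceType) (x0 : T) :=
  isPointed.Build (pointed_at x0) x0.

Definition borel (T : topologicalType) (x0 : T) :=
  g_sigma_algebraType (@open T : set (set (pointed_at x0))).

Section spectral_measures.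
Variables (R : realType) (H : hilbertType R) (T : topologicalType).
Implicit Types (P : set T -> H -> H) (a : T -> R[i]) (xi : H).

Definition borel_set (A : set T) : Prop := <<s @open T >> A.

(* mu is the measure A |-> (P(A) xi, xi), which is real since P(A) is an
   orthogonal projector. *)
Definition mass_of P xi (x0 : T) (mu : {measure set (borel x0) -> \bar R}) :=
  forall A, borel_set A -> mu A = (complex.Re (inner (P A xi) xi))%:E.

(* On empty T there is no base point and the second clause is void; in
   spectral_geometry below, a unital representation of the functions on an empty
   T forces H = 0, so nothing is lost. *)
Definition spectral_measure P : Prop :=
  (forall A, borel_set A -> orthogonal_projector (P A)) /\
  (forall xi x0, exists mu : {measure set (borel x0) -> \bar R}, mass_of P xi mu).

(* U is the integral of a with respect to P, characterized by its quadratic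
   form; mu is determined by P and xi. *)
Definition spectral_integral P a (U : H -> H) : Prop :=
  forall xi x0 (mu : {measure set (borel x0) -> \bar R}), mass_of P xi mu ->
  inner (U xi) xi =
    (\int[mu]_p complex.Re (a p)) +i* (\int[mu]_p complex.Im (a p)).

End spectral_measures.

Section spectral_geometry.
Variables (R : realType) (X : metricType R).

Definition lipschitz_fun (a : X -> R[i]) : Prop :=
  exists k : R, forall x y, `|a x - a y| <= (k * mdist x y)%:C.

Definition flip (p : X * X) : X * X := (p.2, p.1).

(* The set A_lambda; its complement is Lambda_lambda. *)
Definition spectral_complement (H : hilbertType R)
    (P : set (X * X) -> H -> H) (ds : H -> H) (lambda : R[i]) : set (X * X) :=
  \bigcup_(A in [set A | open A /\
    range (P A) `<=` orthogonal_complement (sq_eigenspace ds lambda)]) A.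

(* The algebra is that of Lipschitz functions on X. *)
Record spectral_triple := SpectralTriple {
  st_space : hilbertType R ;
  st_rep : (X -> R[i]) -> st_space -> st_space ;
  st_ds : st_space -> st_space }.

Definition spectral_geometry (G : spectral_triple) : Prop :=
  let rep := @st_rep G in
  let ds := @st_ds G in
  [/\ star_representation lipschitz_fun rep,
      [/\ bounded_operator ds, injective ds, compact_operator ds
        & self_adjoint ds]
    & exists (rept : (X * X -> R[i]) -> st_space G -> st_space G)
             (P : set (X * X) -> st_space G -> st_space G),
      [/\ [/\ star_representation [set a | continuous a] rept,
              forall a, lipschitz_fun a ->
                forall xi, rep a xi = rept (fun p => a p.1) xi,
              spectral_measure P
            & forall a, continuous a -> spectral_integral P a (rept a)],
          forall A, borel_set A ->
            forall xi, ds (P A xi) = P (flip @` A) (ds xi),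
          forall lambda, is_eigenvalue ds lambda ->
            orthogonal_projector (P (spectral_complement P ds lambda)) /\
            range (P (spectral_complement P ds lambda)) =
              orthogonal_complement (sq_eigenspace ds lambda)
        & forall lambda, is_eigenvalue ds lambda ->
            forall p, (~` spectral_complement P ds lambda) p ->
              (mdist p.1 p.2)%:C = `|lambda| ]].

End spectral_geometry.

Section l2_of.
Variables (R : realType) (I : choiceType) (n : I -> nat).
Implicit Types f : forall k, 'rV[R[i]]_(n k).

(* The junk value 0 is never met in the triple below when X is compact: see
   M_repE and M_dsE. *)
Definition l2_of f : l2 R n :=
  if pselect (sqsummable f) is left fP then L2 fP else 0.

Lemma l2_ofE f k : sqsummable f -> l2_of f k = f k.
Proof. by rewrite /l2_of; case: pselect. Qed.

Lemma sqsummable_bounded_scale (c : I -> R[i]) (M : R) f :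
  (forall k, `|c k| <= M%:C) -> sqsummable f ->
  sqsummable (fun k => c k *: f k).
Proof.
rewrite !sqsummableE => cM /(asummableZ (M ^+ 2)); apply: asummable_le => k.
rewrite ger0_norm ?row_sqnorm_ge0// row_sqnormZ ler_wpM2r ?row_sqnorm_ge0//.
have M0 : 0 <= M by rewrite -ler0c (le_trans _ (cM k)).
rewrite -lecR add_Re2_Im2 rmorphXn/=.
by apply: lerXn2r; rewrite ?nnegrE ?normr_ge0 ?ler0c ?cM.
Qed.

End l2_of.

Lemma row_sqnorm_cast (R : realType) (p q : nat) (e : p = q) (u : 'rV[R[i]]_p) :
  row_sqnorm (castmx (erefl 1%N, e) u) = row_sqnorm u.
Proof. by case: _ / e; rewrite castmx_id. Qed.

Section M_triple.
Variables (R : realType) (X : metricType R) (B : set (X * X)).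
Hypothesis Bsym : forall y y', B (y, y') <-> B (y', y).

Lemma flip_in_subproof (b : B) : flip (val b) \in B.
Proof.
by case: b => -[y y'] yB; apply/mem_set/(Bsym y y'); exact: set_mem yB.
Qed.

Definition flipB (b : B) : B := exist _ (flip (val b)) (flip_in_subproof b).

Lemma flipBK : involutive flipB.
Proof. by move=> b; apply: val_inj => /=; case: (val b). Qed.

Variable m : B -> nat.
Hypothesis msym : forall b, m (flipB b) = m b.

Definition M_rep (a : X -> R[i]) (xi : l2 R m) : l2 R m :=
  l2_of (fun b => a (val b).1 *: xi b).

Definition M_ds (xi : l2 R m) : l2 R m :=
  l2_of (fun b => (mdist (val b).1 (val b).2)%:C *:
                  castmx (erefl 1%N, msym b) (xi (flipB b))).

Definition M_triple : spectral_triple X := SpectralTriple M_rep M_ds.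

Lemma compact_mdist_bounded : compact [set: X] ->
  exists D : R, forall x y : X, mdist x y <= D.
Proof.
move=> cX; have [[x0]|X0] := pselect (inhabited X); last first.
  by exists 0 => x; exfalso; apply: X0.
have cd : continuous (fun x : X => mdist x0 x : R).
  move=> x; apply/cvgrPdist_lt => e e0.
  apply: filterS (nbhsx_ballx x _ e0) => y; rewrite ballEmdist/= => xy.
  rewrite ltr_distl; have := metric_triangle x0 x y.
  by have := metric_triangle x0 y x; rewrite (metric_sym y x); lra.
have := continuous_compact (continuous_subspaceT cd) cX.
move=> /compact_bounded[M [_ MX]]; exists (2 * (M + 1)) => x y.
have H z : mdist x0 z <= M + 1.
  apply: le_trans (ler_norm _) _; apply: (MX (M + 1)); first by rewrite ltrDl.
  by exists z.
by have := metric_triangle x x0 y; have := H x; have := H y;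
  rewrite (metric_sym x x0); lra.
Qed.

Lemma sqsummable_flip (xi : l2 R m) :
  sqsummable (fun b => castmx (erefl 1%N, msym b) (xi (flipB b))).
Proof.
have := l2P xi; rewrite /sqsummable.
under [in X in _ -> X]eq_esum do rewrite row_sqnorm_cast.
rewrite (reindex_esum [set: B] [set: B] flipB)//.
by split=> // [x y _ _ /(inv_inj flipBK)//|b _]; exists (flipB b);
  rewrite ?flipBK.
Qed.

Lemma M_repE (a : X -> R[i]) xi b :
  compact [set: X] -> lipschitz_fun a -> M_rep a xi b = a (val b).1 *: xi b.
Proof.
move=> /compact_mdist_bounded[D DX] [k ak]; rewrite l2_ofE//.
have [x0 _] := val b.
have /complex_realP[r ar] : `|a x0| \is Num.real by exact: normr_real.
apply: (sqsummable_bounded_scale (M := `|k| * D + r)) (l2P xi) => c.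
rewrite rmorphD/= -ar -[X in `|X|](subrK (a x0)).
apply: le_trans (ler_normD _ _) _; rewrite lerD2r.
apply: le_trans (ak _ _) _; rewrite lecR.
apply: le_trans (ler_wpM2r (mdist_ge0 _ _) (ler_norm k)) _.
by rewrite ler_wpM2l.
Qed.

Lemma M_dsE xi b : compact [set: X] -> M_ds xi b =
  (mdist (val b).1 (val b).2)%:C *: castmx (erefl 1%N, msym b) (xi (flipB b)).
Proof.
move=> /compact_mdist_bounded[D DX]; rewrite l2_ofE//.
apply: (sqsummable_bounded_scale (M := D)) (sqsummable_flip xi) => c.
by rewrite ger0_norm ?ler0c ?mdist_ge0// lecR.
Qed.

End M_triple.

(* Main.v *)
(** Every operator in sight is a multiplication operator on the Hilbert sum of
    the C^(m b), b in B, except [ds], which is multiplication by the length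
    composed with the flip of B.  The representation of the continuous functions
    on X^2 is multiplication by their restriction to B, and P(A) cuts
    sections off to the intersection of A and B; as B is countable,
    (P(A) xi, xi) is a countable sum of point masses, so integrals against it
    are sums over B.
    The image of the unit ball under [ds] lies in the ellipsoid
    sum_b |xi b|^2 / |b|^2 <= 1, which is compact because |b| tends to 0 along B.
    Since [ds]^2 is multiplication by |b|^2, the space L_lambda consists of the
    sections supported where |b| = |lambda|, and Lambda_lambda is the finite set
    of those b with |b| = |lambda| and m b > 0. *)
Require Import Defs.
From mathcomp Require Import all_boot all_order all_algebra.
From mathcomp Require Import all_classical all_reals all_analysis.
From mathcomp Require Import measurable_realfun complex lra.
Import Order.TTheory GRing.Theory Num.Theory.
Import numFieldNormedType.Exports.
Local Open Scope classical_set_scope.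
Local Open Scope ring_scope.

Set Implicit Arguments.
Unset Strict Implicit.
Unset Printing Implicit Defensive.

(** * Multiplication operators on a Hilbert sum *)

Section multiplication.
Variables (R : realType) (I : choiceType) (n : I -> nat).
Implicit Types (c d : I -> R[i]) (x y : l2 R n) (T : l2 R n -> l2 R n).

Definition bounded_family c := exists M : R, forall k, `|c k| <= M%:C%C.

(** Total in [c] because [l2_of] supplies a default value; it multiplies coordinatewise as soon as
    [c] is bounded. *)
Definition mult c x : l2 R n := l2_of (fun k => c k *: x k).

Lemma multE c x k : bounded_family c -> mult c x k = c k *: x k.
Proof.
by case=> M cM; rewrite /mult l2_ofE//; exact: sqsummable_bounded_scale cM (l2P x).
Qed.

Lemma l2_bounded_operator T (M : R) : linear T ->
  (forall x, l2_sqnorm (T x) <= M ^+ 2 * l2_sqnorm x) -> bounded_operator T.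
Proof.
move=> lT TM; split=> // x.
apply/(@cvgrPdist_lt _ _ _ (nbhs x) (nbhs_filter x)) => e e0.
(* [M] may be negative or zero, hence the radius [d / (|M| + 1)] rather than [d / M]. *)
have M0 : 0 < `|M| + 1 by rewrite ltr_wpDl.
have [d d0 ed] : exists2 d : R, 0 < d & e = d%:C%C.
  have /complex_realP[d ed] : e \is Num.real by exact: gtr0_real.
  by exists d => //; rewrite -ltcR -ed.
have dM : 0 < d / (`|M| + 1) by rewrite divr_gt0.
have : nbhs x (ball x (d / (`|M| + 1))%:C%C) by apply: nbhsx_ballx; rewrite ltcR.
apply: filterS => y; rewrite l2_ballE// => xy.
have -> : T x - T y = T (x - y).
  by rewrite addrC -scaleN1r -lT scaleN1r addrC.
rewrite l2_normE ed ltcR -[ltRHS](ger0_norm (ltW d0)) -sqrtr_sqr.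
rewrite ltr_sqrt ?exprn_gt0//; apply: le_lt_trans (TM _) _.
have [M1|M1] := eqVneq M 0; first by rewrite M1 expr0n mul0r exprn_gt0.
have M2 : 0 < M ^+ 2 by rewrite lt_neqAle sqr_ge0 eq_sym sqrf_eq0 M1.
apply: (@lt_le_trans _ _ (M ^+ 2 * (d / (`|M| + 1)) ^+ 2)).
  by rewrite ltr_pM2l.
rewrite exprMn mulrCA ler_piMr ?sqr_ge0// exprVn.
rewrite ler_pdivrMr ?exprn_gt0// mul1r -real_normK ?num_real//.
by rewrite lerXn2r ?nnegrE// ?(ltW M0)// lerDl.
Qed.

Lemma mult_linear c : bounded_family c -> linear (mult c).
Proof.
move=> cb a x y; apply: l2_ext => k.
by rewrite l2DE l2ZE !multE// l2DE l2ZE scalerDr !scalerA mulrC.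
Qed.

Lemma Re2_Im2_le (a : R[i]) (M : R) : `|a| <= M%:C%C ->
  complex.Re a ^+ 2 + complex.Im a ^+ 2 <= M ^+ 2.
Proof.
move=> aM; have M0 : 0 <= M by rewrite -ler0c (le_trans _ aM).
rewrite -lecR add_Re2_Im2 rmorphXn/=.
by apply: lerXn2r; rewrite ?nnegrE ?normr_ge0 ?ler0c.
Qed.

Lemma l2_sqnorm_le (M : R) x y : 0 <= M ->
  (forall k, row_sqnorm (x k) <= M * row_sqnorm (y k)) ->
  l2_sqnorm x <= M * l2_sqnorm y.
Proof.
move=> M0 xy; rewrite -lee_fin EFinM !fineK ?l2_sqnorm_fin//.
rewrite -esumZ//; last by move=> k; exact: row_sqnorm_ge0.
by apply: le_esum => k _; rewrite lee_fin.
Qed.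

Lemma mult_bounded c : bounded_family c -> bounded_operator (mult c).
Proof.
move=> cb; have [M cM] := cb.
apply: (@l2_bounded_operator _ M); first exact: mult_linear.
move=> x; apply: l2_sqnorm_le => [|k]; first exact: sqr_ge0.
by rewrite multE// row_sqnormZ ler_wpM2r ?row_sqnorm_ge0 ?Re2_Im2_le.
Qed.

Lemma row_dotZr (p : nat) (a : R[i]) (u v : 'rV[R[i]]_p) :
  row_dot u (a *: v) = (a^*)%C * row_dot u v.
Proof. by rewrite row_dotC row_dotZl rmorphM/= -row_dotC. Qed.

Lemma l2_innerE x y : inner x y = csum (fun k => row_dot (x k) (y k)).
Proof. by []. Qed.

Lemma mult_adjoint c x y : bounded_family c ->
  inner (mult (fun k => ((c k)^*)%C) x) y = inner x (mult c y).
Proof.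
move=> cb; have cb' : bounded_family (fun k => ((c k)^*)%C).
  by have [M cM] := cb; exists M => k; rewrite normcJ.
rewrite !l2_innerE; congr csum; apply/funext => k.
by rewrite !multE// row_dotZl row_dotZr.
Qed.

Lemma bounded_familyM c d : bounded_family c -> bounded_family d ->
  bounded_family (fun k => c k * d k).
Proof.
move=> [M cM] [N dN]; exists (M * N) => k.
by rewrite normrM rmorphM/= ler_pM.
Qed.

Lemma bounded_familyD c d : bounded_family c -> bounded_family d ->
  bounded_family (fun k => c k + d k).
Proof.
move=> [M cM] [N dN]; exists (M + N) => k.
by rewrite rmorphD/= (le_trans (ler_normD _ _))// lerD.
Qed.

Lemma bounded_family_cst (a : R[i]) : bounded_family (fun=> a).
Proof.
have /complex_realP[M aM] : `|a| \is Num.real by exact: normr_real.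
by exists M => k; rewrite -aM.
Qed.

(** Covers both representations of the triple: [f] is the inclusion of B for functions on X^2, and
    its first coordinate for functions on X. *)
Lemma mult_star_representation (X : Type) (f : I -> X) (S : set (X -> R[i])) :
  (forall a, S a -> bounded_family (a \o f)) ->
  star_representation S (fun a => mult (a \o f)).
Proof.
move=> Sb; split.
- by move=> a /Sb; exact: mult_bounded.
- move=> x; apply: l2_ext => k; rewrite multE ?scale1r//.
  exact: bounded_family_cst.
- move=> a b /Sb ab /Sb bb x; apply: l2_ext => k.
  apply: etrans (multE x k (bounded_familyD ab bb)) _.
  by rewrite l2DE (multE x k ab) (multE x k bb) scalerDl.
- move=> c a /Sb ab x; apply: l2_ext => k.
  apply: etrans (multE x k (bounded_familyM (bounded_family_cst c) ab)) _.
  by rewrite l2ZE (multE x k ab) scalerA.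
- move=> a b /Sb ab /Sb bb x; apply: l2_ext => k.
  apply: etrans (multE x k (bounded_familyM ab bb)) _.
  by rewrite (multE _ k ab) (multE x k bb) scalerA.
- by move=> a /Sb ab x y; exact: mult_adjoint.
Qed.

Lemma bounded_family_indic (A : set I) : bounded_family (fun k => (k \in A)%:R).
Proof.
exists 1 => j.
by case: (j \in A); rewrite ?normr1 ?normr0 ?lexx ?ler01.
Qed.

Definition l2_restrict (A : set I) : l2 R n -> l2 R n :=
  mult (fun k => (k \in A)%:R).

Lemma l2_restrictE A x k : l2_restrict A x k = if k \in A then x k else 0.
Proof.
rewrite /l2_restrict (multE _ _ (bounded_family_indic A)).
by case: (k \in A); rewrite ?scale1r ?scale0r.
Qed.

Lemma row_dot0l (p : nat) (u : 'rV[R[i]]_p) : row_dot 0 u = 0.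
Proof. by rewrite -(scale0r 0) row_dotZl mul0r. Qed.

Lemma row_dot0r (p : nat) (u : 'rV[R[i]]_p) : row_dot u 0 = 0.
Proof. by rewrite row_dotC row_dot0l rmorph0. Qed.

Lemma l2_restrict_projector A : orthogonal_projector (l2_restrict A).
Proof.
split; first exact: (mult_bounded (bounded_family_indic A)).
- move=> x y; rewrite !l2_innerE; congr csum; apply/funext => k.
  by rewrite !l2_restrictE; case: ifP => // _; rewrite row_dot0l row_dot0r.
- move=> x; apply: l2_ext => k; rewrite !l2_restrictE.
  by case: (k \in A).
Qed.

Lemma inner_mult c x : bounded_family c ->
  inner (mult c x) x = csum (fun k => c k * (row_sqnorm (x k))%:C%C).
Proof.
move=> cb; rewrite l2_innerE; congr csum; apply/funext => k.
by rewrite multE// row_dotZl row_dotxx.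
Qed.

End multiplication.

(** * Countable sums of point masses, and Borel measurability *)

Section discrete_measure.
Local Open Scope ereal_scope.
Variables (R : realType) (I : choiceType).

(** Terms off the range of [f] vanish, and [f] is a bijection from I onto its range. *)
Lemma nneseries_esum_inj (f : I -> nat) (u : nat -> \bar R) : injective f ->
  (forall k, 0 <= u k) -> (forall k, ~ range f k -> u k = 0) ->
  \sum_(k <oo) u k = \esum_(i in [set: I]) u (f i).
Proof.
move=> fI u0 uf; rewrite nneseries_esumT//.
rewrite -(@reindex_esum _ _ _ [set: I] (range f) f u).
  rewrite [RHS]esum_mkcond; apply: eq_esum => k _.
  by case: ifPn => // /negP kf; apply: uf => /mem_set.
by split=> // x y _ _ /fI.
Qed.

(** The measure is the sum of the masses [w i] at the points [p i], numbered through an injection of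
    I into the natural numbers. *)
Lemma discrete_measure_exists d (T : measurableType d) (p : I -> T)
    (w : I -> {nonneg R}) : countable [set: I] ->
  exists mu : {measure set T -> \bar R}, forall g : T -> \bar R,
    measurable_fun setT g -> (forall t, 0 <= g t) ->
    \int[mu]_t g t = \esum_(i in [set: I]) ((w i)%:num%R%:E * g (p i)).
Proof.
move=> /countable_injP[f fI]; have {}fI : injective f.
  by move=> i j; apply: fI; rewrite inE.
(* Weights and points are carried along [f]; a number outside its range gets weight 0, so that the
   point chosen there has no effect. *)
pose a k := if pselect (exists i, f i = k) is left e then w (projT1 (cid e))
            else NngNum (lexx (0%R : R)).
pose q k := if pselect (exists i, f i = k) is left e then p (projT1 (cid e))
            else point.
have aE i : a (f i) = w i.
  rewrite /a; case: pselect => [e|[]]; last by exists i.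
  by case: (cid e) => j /= /fI ->.
have qE i : q (f i) = p i.
  rewrite /q; case: pselect => [e|[]]; last by exists i.
  by case: (cid e) => j /= /fI ->.
pose mu := mseries (fun k => mscale (a k) (\d_(q k))) 0.
exists mu => g mg g0; rewrite ge0_integral_measure_series//.
rewrite (eq_eseriesr (g := fun k => (a k)%:num%R%:E * g (q k))); last first.
  move=> k _; rewrite ge0_integral_mscale// integral_dirac//.
  by rewrite diracT mul1e.
rewrite (nneseries_esum_inj fI).
- by apply: eq_esum => i _; rewrite aE qE.
- by move=> k; rewrite mule_ge0.
- move=> k kf; rewrite /a; case: pselect => [[i ik]|_]; last by rewrite mul0e.
  by exfalso; apply: kf; exists i.
Qed.

End discrete_measure.

(** Open intervals generate the Borel sets of the line, and their preimages are open. *)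
Lemma continuous_borel_measurable (R : realType) (T : topologicalType) (x0 : T)
    (f : T -> R) : continuous f ->
  measurable_fun setT (f : borel x0 -> R).
Proof.
move=> /continuousP cf; apply: (measurability _ (RGenOpens.measurableE R)).
move=> _ [_ [a [b ->] <-]]; rewrite setTI.
by apply: sub_sigma_algebra; apply: cf; exact: interval_open.
Qed.

(** * Continuous complex functions, and their boundedness on compact spaces *)

Section complex_continuity.
Variable R : realType.

Lemma norm_Re_le (z : R[i]) : `|complex.Re z|%:C%C <= `|z|.
Proof.
rewrite normc_def lecR -sqrtr_sqr; apply: ler_wsqrtr.
by rewrite lerDl sqr_ge0.
Qed.

Lemma norm_Im_le (z : R[i]) : `|complex.Im z|%:C%C <= `|z|.
Proof.
rewrite normc_def lecR -sqrtr_sqr; apply: ler_wsqrtr.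
by rewrite lerDr sqr_ge0.
Qed.

Lemma norm_le_Re_Im (z : R[i]) :
  `|z| <= (`|complex.Re z| + `|complex.Im z|)%:C%C.
Proof.
rewrite {1}[z]complexE (le_trans (ler_normD _ _))// rmorphD/= normrM.
by rewrite !normc_def /= !expr0n !addr0 !expr1n add0r sqrtr1 mul1r !sqrtr_sqr.
Qed.

Lemma continuous_Re : continuous (@complex.Re R).
Proof.
move=> z; apply/(@cvgrPdist_lt _ _ _ (nbhs z) (nbhs_filter z)) => e e0.
have : nbhs z (ball z e%:C%C) by apply: nbhsx_ballx; rewrite ltcR.
apply: filterS => w; rewrite -ball_normE /ball_/= => zw.
by rewrite -ltcR; apply: le_lt_trans zw; rewrite -raddfB; exact: norm_Re_le.
Qed.

Lemma continuous_Im : continuous (@complex.Im R).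
Proof.
move=> z; apply/(@cvgrPdist_lt _ _ _ (nbhs z) (nbhs_filter z)) => e e0.
have : nbhs z (ball z e%:C%C) by apply: nbhsx_ballx; rewrite ltcR.
apply: filterS => w; rewrite -ball_normE /ball_/= => zw.
by rewrite -ltcR; apply: le_lt_trans zw; rewrite -raddfB; exact: norm_Im_le.
Qed.

Lemma continuous_ReP (T : topologicalType) (a : T -> R[i]) : continuous a ->
  continuous (fun t => complex.Re (a t)).
Proof.
by move=> ca t; apply: (@continuous_comp _ _ _ a); [exact: ca|exact: continuous_Re].
Qed.

Lemma continuous_ImP (T : topologicalType) (a : T -> R[i]) : continuous a ->
  continuous (fun t => complex.Im (a t)).
Proof.
by move=> ca t; apply: (@continuous_comp _ _ _ a); [exact: ca|exact: continuous_Im].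
Qed.

Lemma compact_real_bounded (T : topologicalType) (f : T -> R) :
  compact [set: T] -> continuous f -> exists M : R, forall t, `|f t| <= M.
Proof.
move=> cT cf; have := continuous_compact (continuous_subspaceT cf) cT.
move=> /compact_bounded[M [_ Mf]]; exists (M + 1) => t.
by apply: (Mf (M + 1)); [rewrite ltrDl|exists t].
Qed.

Lemma compact_complex_bounded (T : topologicalType) (a : T -> R[i]) :
  compact [set: T] -> continuous a ->
  exists M : R, forall t, `|a t| <= M%:C%C.
Proof.
move=> cT ca.
have [M aM] := compact_real_bounded cT (continuous_ReP ca).
have [N aN] := compact_real_bounded cT (continuous_ImP ca).
exists (M + N) => t; apply: le_trans (norm_le_Re_Im _) _.
by rewrite lecR lerD.
Qed.

End complex_continuity.

(** * The spectral measure of the multiplication operators *)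

Section diagonal_spectral_measure.
Variables (R : realType) (I : choiceType) (n : I -> nat).
Variables (T : topologicalType) (p : I -> T).
Hypothesis I_countable : countable [set: I].
Implicit Types (xi : l2 R n) (a : T -> R[i]).

Lemma Re_inner_mult (c : I -> R[i]) xi : bounded_family c ->
  complex.Re (inner (mult c xi) xi) =
  rsum (fun k => complex.Re (c k) * row_sqnorm (xi k)).
Proof.
move=> cb; rewrite inner_mult//; apply: eq_rsum => k.
by case: (c k) => x y /=; rewrite mulr0 subr0.
Qed.

Lemma Im_inner_mult (c : I -> R[i]) xi : bounded_family c ->
  complex.Im (inner (mult c xi) xi) =
  rsum (fun k => complex.Im (c k) * row_sqnorm (xi k)).
Proof.
move=> cb; rewrite inner_mult//; apply: eq_rsum => k.
by case: (c k) => x y /=; rewrite mulr0 add0r.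
Qed.

Lemma asummable_bounded_sqnorm (f : I -> R) (M : R) xi :
  (forall k, `|f k| <= M) -> asummable (fun k => f k * row_sqnorm (xi k)).
Proof.
move=> fM; have := l2P xi; rewrite sqsummableE => /(asummableZ M).
apply: asummable_le => k.
by rewrite normrM (ger0_norm (row_sqnorm_ge0 _)) ler_wpM2r ?row_sqnorm_ge0.
Qed.

(** The joint spectral measure of the multiplications by [a \o p]; it is carried by the image of
    [p]. *)
Definition diag_measure (A : set T) : l2 R n -> l2 R n :=
  l2_restrict (p @^-1` A).

(** The right side is the integral of the indicator of [A] against the point masses
    [row_sqnorm (xi k)] at [p k]. *)
Lemma diag_massE A xi : (complex.Re (inner (diag_measure A xi) xi))%:E =
  (\esum_(k in [set: I]) ((row_sqnorm (xi k))%:E * (\1_A (p k))%:E))%E.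
Proof.
have F : (fun k => complex.Re (k \in p @^-1` A)%:R * row_sqnorm (xi k)) =
    (fun k => \1_A (p k) * row_sqnorm (xi k)).
  apply/funext => k; rewrite indicE; congr (_ * _).
  rewrite (_ : (k \in p @^-1` A) = (p k \in A)); first by case: (p k \in A).
  by apply/idP/idP; rewrite !inE.
rewrite /diag_measure /l2_restrict Re_inner_mult; last exact: bounded_family_indic.
rewrite F rsum_ge0E => [|k]; last by rewrite mulr_ge0 ?row_sqnorm_ge0.
rewrite fineK; first by apply: eq_esum => k _; rewrite -EFinM mulrC.
apply: esum_fin => [k|]; first by rewrite mulr_ge0 ?row_sqnorm_ge0.
apply: (asummable_bounded_sqnorm (M := 1)) => k.
by rewrite indicE; case: (_ \in _); rewrite ?normr1 ?normr0 ?ler01.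
Qed.

Lemma diag_mass_exists xi (x0 : T) :
  exists nu : {measure set (borel x0) -> \bar R},
    mass_of diag_measure xi nu /\
    forall g : borel x0 -> \bar R, measurable_fun setT g ->
      (forall t, 0 <= g t)%E ->
      (\int[nu]_t g t =
        \esum_(k in [set: I]) ((row_sqnorm (xi k))%:E * g (p k)))%E.
Proof.
have [nu nuE] := @discrete_measure_exists R I _ (borel x0) p
  (fun k => NngNum (row_sqnorm_ge0 (xi k))) I_countable.
exists nu; split=> [A mA|]; last exact: nuE.
have -> : nu A = (\int[nu]_t (\1_A t)%:E)%E by rewrite integral_indic// setIT.
rewrite nuE; first by rewrite diag_massE.
- exact/measurable_EFinP/measurable_indic.
- by move=> t; rewrite lee_fin.
Qed.

Lemma diag_spectral_measure : spectral_measure diag_measure.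
Proof.
split=> [A _|xi x0]; first exact: l2_restrict_projector.
by have [nu [nuP _]] := diag_mass_exists xi x0; exists nu.
Qed.

(** The masses determine the measure on Borel sets, so [mu] can be exchanged for the discrete
    measure [nu]. Positive and negative parts are then summed separately; the bound [M] makes both
    sums finite. *)
Lemma diag_Rintegral xi (x0 : T) (mu : {measure set (borel x0) -> \bar R})
    (f : T -> R) (M : R) : mass_of diag_measure xi mu -> continuous f ->
  (forall k, `|f (p k)| <= M) ->
  \int[mu]_t f t = rsum (fun k => f (p k) * row_sqnorm (xi k)).
Proof.
move=> mumass cf fM; have [nu [numass nuE]] := diag_mass_exists xi x0.
have mf : measurable_fun setT (EFin \o f : borel x0 -> \bar R).
  apply/measurable_EFinP; exact: continuous_borel_measurable.
rewrite /Rintegral (@eq_measure_integral _ _ _ setT nu mu); last first.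
  by move=> A mA _; rewrite mumass// numass.
have fs := asummable_bounded_sqnorm xi fM.
have key (h : I -> R) : asummable h ->
    (\esum_(k in [set: I]) (Num.max (h k) 0)%:E)%E \is a fin_num.
  by move=> hs; apply: esum_fin => [k|]; [exact: max0_ge0|exact: asummable_max].
rewrite integralE nuE; [|exact: measurable_funepos|by []].
rewrite nuE; [|exact: measurable_funeneg|by []].
rewrite /rsum -fineB; [|exact: key|exact/key/asummableN].
congr (fine (_ - _)); apply: eq_esum => k _.
- by rewrite funeposE /= -EFin_max -EFinM maxr_pMr ?row_sqnorm_ge0// mulr0 mulrC.
- rewrite funenegE /= -EFin_max -EFinM maxr_pMr ?row_sqnorm_ge0// mulr0.
  by rewrite mulrC mulNr.
Qed.

Lemma diag_spectral_integral a : bounded_family (a \o p) -> continuous a ->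
  spectral_integral diag_measure a (mult (a \o p) : l2 R n -> l2 R n).
Proof.
move=> ab ca xi x0 mu mumass; have [M aM] := ab.
have aR k : `|complex.Re (a (p k))| <= M.
  by rewrite -lecR (le_trans (norm_Re_le _) (aM k)).
have aI k : `|complex.Im (a (p k))| <= M.
  by rewrite -lecR (le_trans (norm_Im_le _) (aM k)).
rewrite (diag_Rintegral mumass (continuous_ReP ca) aR).
rewrite (diag_Rintegral mumass (continuous_ImP ca) aI).
rewrite -(Re_inner_mult xi ab) -(Im_inner_mult xi ab).
by case: (inner _ _).
Qed.

End diagonal_spectral_measure.

(** * Compactness of ellipsoids whose semi-axes tend to zero *)

(** The image of [F] lives on the compact interval from [- M] to [M], so it has a cluster point
    there, and an ultrafilter converges to its cluster points. *)
Lemma ultra_bounded_cvg (R : realType) (T : Type) (F : set_system T) (g : T -> R)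
    (M : R) : UltraFilter F -> F [set x | `|g x| <= M] -> cvg (g @ F).
Proof.
move=> FU FM.
have /(_ (g @ F)) := @segment_compact R (- M) M.
case=> [|z [_ gz]].
  rewrite /fmap/=; apply: (filterS _ FM) => x.
  by rewrite /preimage/= in_itv/= ler_norml.
apply/cvg_ex; exists z => A zA.
have [//|nA] := in_ultra_setVsetC (g @^-1` A) FU.
have [] // := gz (~` A) A nA zA.
by move=> y [].
Qed.

Section ellipsoid.
Variables (R : realType) (I : choiceType) (n : I -> nat).
Implicit Types x y : l2 R n.

Lemma l2_near (x : l2 R n) (d : R) : 0 < d ->
  \forall y \near nbhs x, Num.sqrt (l2_sqnorm (x - y)) < d.
Proof.
move=> d0; have : nbhs x (ball x d%:C%C) by apply: nbhsx_ballx; rewrite ltcR.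
apply: filterS => y; rewrite l2_ballE// => xy.
by rewrite -[ltRHS](ger0_norm (ltW d0)) -sqrtr_sqr ltr_sqrt// exprn_gt0.
Qed.

Lemma continuous_l2_Re k (j : 'I_(n k)) :
  continuous (fun x : l2 R n => complex.Re (x k 0 j) : R).
Proof.
move=> x; apply/(@cvgrPdist_lt _ _ _ (nbhs x) (nbhs_filter x)) => e e0.
apply: filterS (l2_near x e0) => y; apply: le_lt_trans.
by have := (l2_coord_le (x - y) j).1; rewrite l2DE l2NE !mxE raddfB.
Qed.

Lemma continuous_l2_Im k (j : 'I_(n k)) :
  continuous (fun x : l2 R n => complex.Im (x k 0 j) : R).
Proof.
move=> x; apply/(@cvgrPdist_lt _ _ _ (nbhs x) (nbhs_filter x)) => e e0.
apply: filterS (l2_near x e0) => y; apply: le_lt_trans.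
by have := (l2_coord_le (x - y) j).2; rewrite l2DE l2NE !mxE raddfB.
Qed.

Lemma continuous_l2_row_sqnorm k :
  continuous (fun x : l2 R n => row_sqnorm (x k)).
Proof.
move=> x; apply: (@cvg_rsum_seq R _ (nbhs x) (nbhs_filter x)) => j.
apply: (@cvgD _ _ _ (nbhs x) (nbhs_filter x));
  apply: (@cvgM _ _ (nbhs x) (nbhs_filter x)).
- exact: continuous_l2_Re.
- exact: continuous_l2_Re.
- exact: continuous_l2_Im.
- exact: continuous_l2_Im.
Qed.

Variable l : I -> R.
Hypothesis l_gt0 : forall k, 0 < l k.
Hypothesis l_fin : forall t, 0 < t -> finite_set [set k | t <= l k].

(** The image of the closed unit ball under multiplication by [l]. *)
Definition ellipsoid : set (l2 R n) :=
  [set x | (\esum_(k in [set: I]) (row_sqnorm (x k) / l k ^+ 2)%:E <= 1)%E].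

Lemma ellipsoid_term_ge0 x k : 0 <= row_sqnorm (x k) / l k ^+ 2.
Proof. by rewrite divr_ge0 ?row_sqnorm_ge0// sqr_ge0. Qed.

Lemma ellipsoid_term_le x k : ellipsoid x -> row_sqnorm (x k) <= l k ^+ 2.
Proof.
move=> Ux; rewrite -[leRHS]mul1r -ler_pdivrMr ?exprn_gt0// -lee_fin.
apply: le_trans Ux; apply: esum_ge.
by exists [set k]; rewrite ?fsbig_set1.
Qed.

(** The unordered sum is the supremum of its finite partial sums, each of which is continuous in
    [x]. *)
Lemma ellipsoid_closed : closed ellipsoid.
Proof.
have -> : ellipsoid = \bigcap_(S in [set S : set I | finite_set S])
    ((fun x : l2 R n => \sum_(k <- finmap.enum_fset (fset_set S))
        row_sqnorm (x k) / l k ^+ 2) @^-1` [set r | r <= 1]).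
  apply/seteqP; split=> [x Ux S finS|x Ux].
    rewrite /preimage/= -lee_fin -sumEFin -fsbig_finite//.
    apply: le_trans Ux; apply: esum_ge; exists S => //.
  apply: ge_ereal_sup => _ [S [finS _]] <-.
  by rewrite fsbig_finite// sumEFin lee_fin; exact: (Ux S finS).
apply: closed_bigI => S _; apply: preimage_closed; last exact: closed_le.
move=> x _; apply: (@cvg_rsum_seq R _ (nbhs x) (nbhs_filter x)) => k.
apply: (@cvgMr_tmp _ _ (nbhs x) (nbhs_filter x)); exact: continuous_l2_row_sqnorm.
Qed.

(** A triangle inequality through [w] for squared norms, at the price of a factor 2. *)
Lemma row_sqnormB (p : nat) (u v w : 'rV[R[i]]_p) :
  row_sqnorm (u - v) <= 2 * row_sqnorm (u - w) + 2 * row_sqnorm (v - w).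
Proof.
have -> : u - v = (u - w) + (-1) *: (v - w).
  by rewrite scaleN1r opprB addrA subrK.
apply: le_trans (row_sqnormD _ _) _.
by rewrite row_sqnormZ /= oppr0 expr0n/= addr0 sqrrN expr1n mul1r.
Qed.

(** On the ellipsoid the real and imaginary parts of row [k] are bounded by [l k], so each converges
    along the ultrafilter; [z] collects the limits. *)
Lemma ellipsoid_row_limit (F : set_system (l2 R n)) k :
  UltraFilter F -> F ellipsoid ->
  exists z : 'rV[R[i]]_(n k), row_sqnorm ((x : l2 R n) k - z) @[x --> F] --> (0 : R).
Proof.
move=> FU FE.
have bound x j : ellipsoid x -> `|complex.Re (x k 0 j)| <= l k /\
    `|complex.Im (x k 0 j)| <= l k.
  move=> /(ellipsoid_term_le k); rewrite /row_sqnorm (bigD1 j)//= => h.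
  have r0 : 0 <= \sum_(i < n k | i != j)
      (complex.Re (x k 0 i) ^+ 2 + complex.Im (x k 0 i) ^+ 2).
    by apply: sumr_ge0 => i _; rewrite addr_ge0 ?sqr_ge0.
  rewrite -(ger0_norm (ltW (l_gt0 k))) -!(sqrtr_sqr) !ler_sqrt ?sqr_ge0//.
  have := sqr_ge0 (complex.Re (x k 0 j)); have := sqr_ge0 (complex.Im (x k 0 j)).
  by split; lra.
have cRe j : cvg ((fun x : l2 R n => complex.Re (x k 0 j) : R) @ F).
  apply: (ultra_bounded_cvg (M := l k)).
  by apply: filterS FE => x /bound-/(_ j)[].
have cIm j : cvg ((fun x : l2 R n => complex.Im (x k 0 j) : R) @ F).
  apply: (ultra_bounded_cvg (M := l k)).
  by apply: filterS FE => x /bound-/(_ j)[].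
pose zR j : R := lim ((fun x : l2 R n => complex.Re (x k 0 j) : R) @ F).
pose zI j : R := lim ((fun x : l2 R n => complex.Im (x k 0 j) : R) @ F).
exists (\row_j (zR j +i* zI j)%C).
rewrite [X in X x @[x --> F]](_ : _ = (fun x : l2 R n => \sum_(j < n k)
    ((complex.Re (x k 0 j) - zR j) * (complex.Re (x k 0 j) - zR j) +
     (complex.Im (x k 0 j) - zI j) * (complex.Im (x k 0 j) - zI j)))); last first.
  apply/funext => x; apply: eq_bigr => j _.
  by rewrite !mxE; case: (x k 0 j) => a b; rewrite -!expr2.
have FF : ProperFilter F by exact: ultra_proper.
rewrite [X in _ --> X](_ : 0 = \sum_(j < n k) ((zR j - zR j) * (zR j - zR j) +
    (zI j - zI j) * (zI j - zI j))); last first.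
  by rewrite big1// => j _; rewrite !subrr mulr0 addr0.
apply: cvg_rsum_seq => j.
by apply: cvgD; apply: cvgM; apply: cvgB;
  [exact: cRe|exact: cvg_cst|exact: cRe|exact: cvg_cst
  |exact: cIm|exact: cvg_cst|exact: cIm|exact: cvg_cst].
Qed.

(** It suffices that an ultrafilter on the ellipsoid is Cauchy: completeness then gives a limit, and
    closedness keeps it in the ellipsoid. *)
Lemma ellipsoid_compact : compact ellipsoid.
Proof.
rewrite compact_ultra => F FU FE.
have FF : ProperFilter F by exact: ultra_proper.
suff : cvg F.
  move=> /cvg_ex[p Fp]; exists p; split=> //.
  exact: (@closed_cvg _ _ F FF id ellipsoid ellipsoid_closed FE p Fp).
apply: l2_complete; apply: cauchy_exP => e e0.
have [d d0 ->] : exists2 d : R, 0 < d & e = d%:C%C.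
  have /complex_realP[d ed] : e \is Num.real by exact: gtr0_real.
  by exists d => //; rewrite -ltcR -ed.
have [z zP] : exists z : forall k, 'rV[R[i]]_(n k),
    forall k, row_sqnorm ((x : l2 R n) k - z k) @[x --> F] --> (0 : R).
  have H k := ellipsoid_row_limit k FU FE.
  by exists (fun k => projT1 (cid (H k))) => k; case: (cid (H k)).
(* With this threshold the small semi-axes contribute at most [2 * (d / 4)^2 * 2 = d^2 / 4]. Taking
   [s] below [d^2 / 16] bounds the finite part [2 * s x + 2 * s y] by [d^2 / 4] as well. *)
have t0 : 0 < d / 4 by rewrite divr_gt0.
have finS := l_fin t0; set S := [set k | d / 4 <= l k] in finS.
pose s (x : l2 R n) :=
  \sum_(k <- finmap.enum_fset (fset_set S)) row_sqnorm (x k - z k).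
have s0 : s x @[x --> F] --> (0 : R).
  rewrite [X in _ --> X](_ : 0 = \sum_(k <- finmap.enum_fset (fset_set S)) 0).
    exact: cvg_rsum_seq.
  by rewrite big1.
have d16 : 0 < d ^+ 2 / 16 by rewrite divr_gt0 ?exprn_gt0.
have FV : F [set x | ellipsoid x /\ s x < d ^+ 2 / 16].
  apply: filterI => //.
  move/cvgrPdist_lt: s0 => /(_ _ d16); apply: filterS => x.
  by rewrite sub0r normrN; apply: le_lt_trans (ler_norm _).
have [x [Ux sx]] := filter_ex FV.
exists x; apply: filterS FV => y [Uy sy]; rewrite l2_ballE//.
have d2 : 0 < d ^+ 2 by rewrite exprn_gt0.
suff : l2_sqnorm (x - y) <= d ^+ 2 / 2 by move=> /le_lt_trans; apply; lra.
rewrite -lee_fin fineK ?l2_sqnorm_fin//.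
(* Coordinates with [l k < d / 4] are controlled by the ellipsoid, the finitely
   many others by convergence. *)
pose a k := 2 * (d / 4) ^+ 2 *
  (row_sqnorm (x k) / l k ^+ 2 + row_sqnorm (y k) / l k ^+ 2).
pose b k := 2 * row_sqnorm (x k - z k) + 2 * row_sqnorm (y k - z k).
have a0 k : 0 <= a k.
  by rewrite mulr_ge0 ?addr_ge0 ?ellipsoid_term_ge0// mulr_ge0 ?sqr_ge0.
have b0 k : 0 <= b k by rewrite addr_ge0// mulr_ge0 ?row_sqnorm_ge0.
have step k : ((row_sqnorm ((x - y) k))%:E <=
    (a k)%:E + (if k \in S then (b k)%:E else 0))%E.
  case: ifPn => kS.
    rewrite -EFinD lee_fin l2DE l2NE; apply: le_trans (row_sqnormB _ _ (z k)) _.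
    by rewrite lerDr.
  (* Here the intermediate vector is 0, and [l k < d / 4] turns each row norm into a multiple of its
     ellipsoid term. *)
  rewrite adde0 lee_fin l2DE l2NE; apply: le_trans (row_sqnormB _ _ 0) _.
  rewrite !subr0 /a -mulrDr -mulrA ler_wpM2l// mulrDr.
  have lk : l k ^+ 2 <= (d / 4) ^+ 2.
    rewrite lerXn2r ?nnegrE ?(ltW (l_gt0 k)) ?(ltW t0)//.
    by move: kS; rewrite notin_setE /S/= => /negP; rewrite -ltNge => /ltW.
  have T (w : l2 R n) :
      row_sqnorm (w k) <= (d / 4) ^+ 2 * (row_sqnorm (w k) / l k ^+ 2).
    rewrite mulrCA ler_peMr ?row_sqnorm_ge0//.
    by rewrite ler_pdivlMr ?mul1r// exprn_gt0.
  by apply: lerD.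
apply: le_trans (le_esum (fun k _ => step k)) _.
rewrite esumD; last 2 first.
- by move=> k _; rewrite lee_fin.
- by move=> k _; case: ifP => // _; rewrite lee_fin.
rewrite -esum_mkcond (@esum_fset R I S _ finS); last by move=> k _; rewrite lee_fin.
rewrite (fsbig_finite _ _ finS)/= sumEFin /b big_split/= -!mulr_sumr -/(s x) -/(s y).
rewrite esumZ; last 2 first.
- by rewrite mulr_ge0 ?sqr_ge0.
- by move=> k; rewrite addr_ge0 ?ellipsoid_term_ge0.
have ab : (\esum_(k in [set: I]) (row_sqnorm (x k) / l k ^+ 2 +
    row_sqnorm (y k) / l k ^+ 2)%:E <= 2%:E)%E.
  under eq_esum do rewrite EFinD.
  rewrite esumD; try by move=> k _; rewrite lee_fin ellipsoid_term_ge0.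
  by rewrite (_ : 2 = 1 + 1 :> R)// EFinD leeD.
have c0 : 0 <= 2 * (d / 4) ^+ 2 by rewrite mulr_ge0 ?sqr_ge0.
apply: le_trans (leeD (lee_wpmul2l _ ab) (lexx _)) _; first by rewrite lee_fin.
by rewrite -EFinM -EFinD lee_fin exprMn exprVn; move: sx sy d2; lra.
Qed.

End ellipsoid.

(** By positivity of [l], the finite sets where [l] is at least [1 / (j + 1)] exhaust I. *)
Lemma countable_pos_weights (R : realType) (I : choiceType) (l : I -> R) :
  (forall k, 0 < l k) -> (forall t, 0 < t -> finite_set [set k | t <= l k]) ->
  countable [set: I].
Proof.
move=> l_gt0 l_fin.
have -> : [set: I] = \bigcup_(j in [set: nat]) [set k | j.+1%:R^-1 <= l k].
  apply/seteqP; split=> // k _; exists (Num.truncn (l k)^-1) => //=.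
  rewrite -[leRHS]invrK lef_pV2 ?posrE ?invr_gt0//.
  exact/ltW/truncnS_gt.
apply: bigcup_countable => // j _; apply: finite_set_countable.
by apply: l_fin; rewrite invr_gt0.
Qed.

(** * Rows transported along equalities of dimensions *)

Section castmx_rows.
Variable R : realType.

Lemma castmx_rowZ (p q : nat) (e : p = q) (a : R[i]) (u : 'rV[R[i]]_p) :
  castmx (erefl 1%N, e) (a *: u) = a *: castmx (erefl 1%N, e) u.
Proof. by case: _ / e; rewrite !castmx_id. Qed.

Lemma castmx_rowD (p q : nat) (e : p = q) (u v : 'rV[R[i]]_p) :
  castmx (erefl 1%N, e) (u + v) = castmx (erefl 1%N, e) u + castmx (erefl 1%N, e) v.
Proof. by case: _ / e; rewrite !castmx_id. Qed.

Lemma castmx_row0 (p q : nat) (e : p = q) :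
  castmx (erefl 1%N, e) (0 : 'rV[R[i]]_p) = 0.
Proof. by case: _ / e; rewrite castmx_id. Qed.

Lemma row_dot_cast (p q : nat) (e : p = q) (u : 'rV[R[i]]_p) (v : 'rV[R[i]]_q) :
  row_dot (castmx (erefl 1%N, e) u) v = row_dot u (castmx (erefl 1%N, esym e) v).
Proof. by case: _ / e v => v; rewrite !castmx_id. Qed.

(** Cancels the cast produced by a double flip; [e] can be any proof, since equality proofs between
    natural numbers are unique. *)
Lemma castmx_family (I : eqType) (n : I -> nat) (x : forall k, 'rV[R[i]]_(n k))
    (j k : I) (jk : j = k) (e : n j = n k) :
  castmx (erefl 1%N, e) (x j) = x k.
Proof. by subst k; rewrite (eq_irrelevance e erefl) castmx_id. Qed.

Lemma castmx_row_irr (p q : nat) (e e' : p = q) (u : 'rV[R[i]]_p) :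
  castmx (erefl 1%N, e) u = castmx (erefl 1%N, e') u.
Proof. by rewrite (eq_irrelevance e e'). Qed.

End castmx_rows.

(** * The operator [ds]: boundedness, injectivity, symmetry, compactness *)

Section flip_operator.
Variables (R : realType) (I : choiceType) (n : I -> nat) (l : I -> R).
Variable flip : I -> I.
Hypothesis flipK : involutive flip.
Hypothesis l_flip : forall k, l (flip k) = l k.
Hypothesis l_gt0 : forall k, 0 < l k.
Hypothesis n_flip : forall k, n (flip k) = n k.
Variable ds : l2 R n -> l2 R n.
Hypothesis dsE : forall x k, ds x k =
  (l k)%:C%C *: castmx (erefl 1%N, n_flip k) (x (flip k)).
Implicit Types x y : l2 R n.

Lemma flip_bij : set_bij [set: I] [set: I] flip.
Proof.
by split=> // [x y _ _ /(inv_inj flipK)//|k _]; exists (flip k).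
Qed.

Lemma ds_sqnormE x b :
  row_sqnorm (ds x b) = l b ^+ 2 * row_sqnorm (x (flip b)).
Proof. by rewrite dsE row_sqnormZ row_sqnorm_cast /= expr0n addr0. Qed.

Lemma ds_dsE x b : ds (ds x) b = ((l b)%:C%C ^+ 2) *: x b.
Proof.
rewrite dsE dsE castmx_rowZ l_flip scalerA -expr2; congr (_ *: _).
rewrite castmx_comp; apply: castmx_family; exact: flipK.
Qed.

Lemma esum_flip (f : I -> \bar R) :
  (\esum_(b in [set: I]) f (flip b) = \esum_(b in [set: I]) f b)%E.
Proof. by rewrite (reindex_esum _ _ _ f flip_bij). Qed.

Lemma rsum_flip (f : I -> R) : rsum (fun b => f (flip b)) = rsum f.
Proof.
rewrite /rsum (esum_flip (fun b => (Num.max (f b) 0)%:E)).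
by rewrite (esum_flip (fun b => (Num.max (- f b) 0)%:E)).
Qed.

Lemma ds_linear : linear ds.
Proof.
move=> a x y; apply: l2_ext => b.
apply: etrans (dsE (a *: x + y) b) _.
rewrite [RHS]l2DE [X in _ = X + _]l2ZE (dsE x b) (dsE y b).
rewrite [(a *: x + y) (flip b)]l2DE [(a *: x) (flip b)]l2ZE.
by rewrite castmx_rowD castmx_rowZ scalerDr !scalerA [_ * a]mulrC.
Qed.

Lemma ds_bounded (D : R) : (forall k, l k <= D) -> bounded_operator ds.
Proof.
(* The sign of [D] is known only in the presence of an index [k]: I may be empty. *)
move=> lD; have D0 (k : I) : 0 <= D by rewrite (le_trans _ (lD k))// ltW.
apply: (@l2_bounded_operator _ _ _ _ D); first exact: ds_linear.
move=> x; rewrite -lee_fin EFinM !fineK ?l2_sqnorm_fin//.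
rewrite -(esum_flip (fun b => (row_sqnorm (x b))%:E)) -esumZ ?sqr_ge0//; last first.
  by move=> b; exact: row_sqnorm_ge0.
apply: le_esum => b _; rewrite lee_fin ds_sqnormE.
rewrite ler_wpM2r ?row_sqnorm_ge0// lerXn2r ?nnegrE ?(D0 b)//.
exact/ltW/l_gt0.
Qed.

(** Already the square of [ds] is injective, as it multiplies row [b] by the nonzero number
    [l b ^+ 2]. *)
Lemma ds_injective : injective ds.
Proof.
move=> x y xy; apply: l2_ext => b.
have E : ds (ds x) b = ds (ds y) b by rewrite xy.
have l0 : (l b)%:C%C ^+ 2 != 0 :> R[i].
  by rewrite sqrf_eq0 fmorph_eq0 gt_eqF ?l_gt0.
exact: (scalerI l0 (etrans (etrans (esym (ds_dsE x b)) E) (ds_dsE y b))).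
Qed.

(** As [l] is real and invariant under the flip, the term at [b] of one sum is the term at [flip b]
    of the other; sums over I do not change under the flip. *)
Lemma ds_self_adjoint : self_adjoint ds.
Proof.
move=> x y; rewrite !l2_innerE /csum.
have E b : row_dot (x b) (ds y b) = row_dot (ds x (flip b)) (y (flip b)).
  rewrite (dsE y b) (dsE x (flip b)) row_dotZl row_dotZr l_flip; congr (_ * _).
    by rewrite /= oppr0.
  (* Writing [x b] as a cast of [x (flip (flip b))] makes both sides casts of the same row. *)
  rewrite row_dot_cast -[x b](castmx_family x (flipK b)
    (etrans (n_flip (flip b)) (n_flip b))).
  rewrite row_dot_cast.
  rewrite castmx_comp; congr row_dot; exact: castmx_row_irr.
rewrite (eq_rsum (fun b => congr1 (@complex.Re R) (E b))).
rewrite [X in _ = (_ +i* X)%C](eq_rsum (fun b => congr1 (@complex.Im R) (E b))).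
rewrite (rsum_flip (fun b => complex.Re (row_dot (ds x b) (y b)))).
by rewrite (rsum_flip (fun b => complex.Im (row_dot (ds x b) (y b)))).
Qed.

(** Dividing the squared norm of row [b] of [ds x] by [l b ^+ 2] leaves that of row [flip b] of [x],
    so the unit ball is mapped into the ellipsoid. *)
Lemma ds_compact : (forall t, 0 < t -> finite_set [set k | t <= l k]) ->
  compact_operator ds.
Proof.
move=> l_fin; have Ecompact := ellipsoid_compact (n := n) l_gt0 l_fin.
have Eclosed := @ellipsoid_closed R I n l.
apply: (@precompact_subset _ _ (@ellipsoid R I n l)); last first.
  by rewrite precompact_closed.
move=> _ [x /= x1 <-]; rewrite /ellipsoid/=.
rewrite (eq_esum (b := fun b => (row_sqnorm (x (flip b)))%:E)); last first.
  move=> b _; rewrite ds_sqnormE mulrAC divff ?mul1r//.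
  by rewrite sqrf_eq0 gt_eqF// l_gt0.
rewrite (esum_flip (fun b => (row_sqnorm (x b))%:E)).
rewrite -(fineK (l2_sqnorm_fin x)) lee_fin -/(l2_sqnorm x).
have : Num.sqrt (l2_sqnorm x) <= 1 by rewrite -lecR.
by rewrite -[leRHS]sqrtr1 ler_sqrt ?ltr01.
Qed.

End flip_operator.

(** * Eigenspaces of the square of [ds] and their supports *)

Lemma csum0 (R : realType) (I : choiceType) : csum (fun _ : I => 0 : R[i]) = 0.
Proof.
have r0 : rsum (fun _ : I => 0 : R) = 0 by rewrite rsum_ge0E// esum1.
by rewrite /csum/= r0.
Qed.

Section eigenspaces.
Variables (R : realType) (I : choiceType) (n : I -> nat) (l : I -> R).
Variable flip : I -> I.
Hypothesis flipK : involutive flip.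
Hypothesis l_flip : forall k, l (flip k) = l k.
Hypothesis l_gt0 : forall k, 0 < l k.
Hypothesis n_flip : forall k, n (flip k) = n k.
Variable ds : l2 R n -> l2 R n.
Hypothesis dsE : forall x k, ds x k =
  (l k)%:C%C *: castmx (erefl 1%N, n_flip k) (x (flip k)).
Implicit Types x y : l2 R n.

Let ds_dsE := ds_dsE flipK l_flip dsE.

Lemma l2_eq0P x : (forall k, x k = 0) -> x = 0.
Proof. by move=> x0; apply: l2_ext => k; rewrite x0. Qed.

(** On a nonzero row [k] of an eigenvector, the square of [ds] acts both as [lambda ^+ 2] and as
    [l k ^+ 2]. *)
Lemma eigenvalue_length lambda : is_eigenvalue ds lambda ->
  exists k, lambda ^+ 2 = (l k)%:C%C ^+ 2.
Proof.
move=> [x x0 dx].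
have [k xk] : exists k, x k != 0.
  apply/not_existsP => xk; move/eqP: x0; apply; apply: l2_eq0P => k.
  by apply/eqP/negPn/negP; exact: xk.
exists k; have E : ds (ds x) k = lambda ^+ 2 *: x k.
  rewrite dsE [in LHS]dx l2ZE castmx_rowZ scalerA mulrC -scalerA -dsE dx l2ZE.
  by rewrite scalerA expr2.
have : (lambda ^+ 2 - (l k)%:C%C ^+ 2) *: x k = 0.
  by rewrite scalerBl -E ds_dsE subrr.
by move=> /eqP; rewrite scaler_eq0 (negbTE xk) orbF subr_eq0 => /eqP.
Qed.

Variables (lambda : R[i]) (r : R).
Hypothesis r_gt0 : 0 < r.
Hypothesis lambda_r : lambda ^+ 2 = r%:C%C ^+ 2.

(** The square of [ds] multiplies row [k] by [l k ^+ 2], and positive reals with equal squares are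
    equal. *)
Lemma sq_eigenspaceP x :
  sq_eigenspace ds lambda x <-> forall k, l k != r -> x k = 0.
Proof.
split=> [Lx k lk|x0].
  have E : (r%:C%C ^+ 2 - (l k)%:C%C ^+ 2) *: x k = 0.
    by rewrite scalerBl -lambda_r -ds_dsE Lx l2ZE subrr.
  move/eqP: E; rewrite scaler_eq0 subr_eq0 => /orP[|/eqP//].
  rewrite -!rmorphXn/= => /eqP/complexI/eqP.
  by rewrite eqrXn2 ?ltW// eq_sym (negbTE lk).
rewrite /sq_eigenspace/= lambda_r; apply: l2_ext => k.
rewrite ds_dsE l2ZE; have [->//|/x0 ->] := eqVneq (l k) r.
by rewrite !scaler0.
Qed.

(** The all-ones row makes a test vector at [k] in every dimension; it is nonzero exactly when
    [0 < n k]. *)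
Lemma row_sqnorm_delta (k j : I) :
  row_sqnorm ((if j == k then const_mx 1 else 0) : 'rV[R[i]]_(n j)) =
  if j == k then (n k)%:R else 0.
Proof.
have [->|_] := eqVneq j k; rewrite /row_sqnorm.
  rewrite (eq_bigr (fun=> 1)) ?sumr_const ?card_ord// => i _.
  by rewrite mxE /= expr0n addr0 expr1n.
by rewrite big1// => i _; rewrite mxE /= expr0n addr0.
Qed.

Lemma sqsummable_delta (k : I) : sqsummable (fun j : I =>
  (if j == k then const_mx 1 else 0) : 'rV[R[i]]_(n j)).
Proof.
rewrite /sqsummable (eq_esum (b := fun j =>
    if j \in [set k] then (n k)%:R%:E else 0%E)); last first.
  move=> j _; rewrite row_sqnorm_delta (_ : (j \in [set k]) = (j == k)).
    by case: ifP.
  by apply/idP/idP; rewrite inE => /eqP.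
by rewrite -esum_mkcond esum_set1 ?ltry// lee_fin.
Qed.

Variables (T : topologicalType) (p : I -> T).
Hypothesis p_inj : injective p.
Hypothesis T_accessible : accessible_space T.
Hypothesis l_fin : forall t, 0 < t -> finite_set [set k | t <= l k].

Let P := @diag_measure R I n T p.
Let L := sq_eigenspace ds lambda.
(** This is Lambda_lambda. Indices with [n k = 0] carry the zero space, invisible to [P], and are
    left out. *)
Let S : set T := p @` [set k | l k = r /\ (0 < n k)%N].

Lemma diag_measureE A x k : P A x k = if p k \in A then x k else 0.
Proof.
rewrite /P /diag_measure l2_restrictE.
by rewrite (_ : (k \in p @^-1` A) = (p k \in A)) //; apply/idP/idP; rewrite !inE.
Qed.

(** Condition (ii), with [A'] in the role of the flipped set. *)
Lemma ds_diag_measure A A' x : (forall k, (p (flip k) \in A) = (p k \in A')) ->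
  ds (P A x) = P A' (ds x).
Proof.
move=> AA'; apply: l2_ext => k; rewrite diag_measureE dsE diag_measureE AA'.
by case: ifP => _; rewrite ?dsE// castmx_row0 scaler0.
Qed.

Lemma support_closed : closed S.
Proof.
apply: accessible_finite_set_closed.1 T_accessible _ _.
apply: finite_image; apply: sub_finite_set (l_fin r_gt0) => k [lk _] /=.
by rewrite lk.
Qed.

Lemma row0_size0 (q : nat) (u v : 'rV[R[i]]_q) : q = 0%N -> u = v.
Proof. by move=> q0; move: u v; rewrite q0 => u v; apply/rowP => -[]. Qed.

(** Each row product vanishes: the left factor if [p k] is outside [A], the right one if [l k]
    differs from [r], both if [n k = 0]. Any other [k] would put [p k] in [A] and [S]. *)
Lemma eigenspace_support_orthogonal A x : A `&` S = set0 ->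
  orthogonal_complement L (P A x).
Proof.
move=> AS y /sq_eigenspaceP y0; rewrite l2_innerE.
rewrite (_ : (fun k => _) = fun=> 0); first exact: csum0.
apply/funext => k; rewrite diag_measureE.
case: ifPn => [/set_mem pA|_]; last by rewrite row_dot0l.
have [lk|/y0 ->] := eqVneq (l k) r; last by rewrite row_dot0r.
have [nk|] := posnP (n k).
  by rewrite (row0_size0 (y k) 0 nk) row_dot0r.
move=> nk; exfalso; suff : (A `&` S) (p k) by rewrite AS.
by split=> //; exists k.
Qed.

(** If an admissible [A] contained some [p k] of [S], the test vector at [k] would lie both in the
    range of [P A] and in [L], hence be orthogonal to itself. Conversely the complement of [S] is
    open and admissible. *)
Lemma largest_orthogonal_open :
  \bigcup_(A in [set A | open A /\ range (P A) `<=` orthogonal_complement L]) A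
  = ~` S.
Proof.
apply/seteqP; split=> [t [A [oA AL] At] [k [lk nk] pk]|t St].
  pose e := L2 (sqsummable_delta k).
  have Le : L e.
    apply/sq_eigenspaceP => j; apply: contraNeq => /= ej.
    by move: ej; case: (eqVneq j k) => [->|]; rewrite ?lk// eqxx.
  have Pe : P A e = e.
    apply: l2_ext => j; rewrite diag_measureE /=.
    have [jk|_] := eqVneq j k; last by case: ifP.
    by rewrite jk pk mem_set.
  have : inner e e = 0 by apply: AL Le; exists e.
  rewrite inner_norm => /eqP; rewrite sqrf_eq0 normr_eq0 => /eqP e0.
  have /rowP/(_ (Ordinal nk)) : e k = 0 by rewrite e0.
  by rewrite /= eqxx !mxE => /eqP; rewrite oner_eq0.
exists (~` S) => //; split; first exact/closed_openC/support_closed.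
by move=> _ [x _ <-]; apply: eigenspace_support_orthogonal; rewrite setICl.
Qed.

Lemma range_complement : range (P (~` S)) = orthogonal_complement L.
Proof.
apply/seteqP; split=> [_ [x _ <-]|x Lx].
  by apply: eigenspace_support_orthogonal; rewrite setICl.
exists x => //; apply: l2_ext => k; rewrite diag_measureE.
case: ifPn => //; rewrite notin_setE/= => /contrapT pS.
have [_ sa idem] := @l2_restrict_projector R I n (p @^-1` S).
have y0 : P S x = 0.
  apply/eqP; rewrite -normr_eq0 -sqrf_eq0 -inner_norm; apply/eqP.
  rewrite sa idem; apply: Lx; apply/sq_eigenspaceP => j lj.
  (* By injectivity of [p], a row kept by [P S] has length [r] at its own index, which places
     [P S x] in [L]. *)
  rewrite diag_measureE; case: ifPn => // /set_mem[i [li _] /p_inj ij].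
  by move: lj; rewrite -ij li eqxx.
have := congr1 (fun y : l2 R n => y k) y0.
by rewrite /= diag_measureE mem_set.
Qed.

End eigenspaces.

(** * The compact metric space X and verification of the conditions *)

Lemma accessible_prod (T U : topologicalType) :
  accessible_space T -> accessible_space U -> accessible_space (T * U)%type.
Proof.
move=> aT aU [x y] [x' y'] xy.
have [xx|xx] := eqVneq x x'; last first.
  have [A [oA Ax Ax']] := aT _ _ xx; exists (fst @^-1` A); split.
  - by apply: open_comp => // z _; exact: cvg_fst.
  - by move: Ax; rewrite !inE.
  - by move: Ax'; rewrite !inE.
have yy : y != y' by apply: contraNneq xy => ->; rewrite xx.
have [A [oA Ay Ay']] := aU _ _ yy; exists (snd @^-1` A); split.
- by apply: open_comp => // z _; exact: cvg_snd.
- by move: Ay; rewrite !inE.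
- by move: Ay'; rewrite !inE.
Qed.

Lemma lipschitz_bounded (R : realType) (X : metricType R) (a : X -> R[i]) :
  compact [set: X] -> lipschitz_fun a ->
  exists M : R, forall x, `|a x| <= M%:C%C.
Proof.
move=> cX [k ak]; apply: compact_complex_bounded => // x.
apply/(@cvgrPdist_lt _ _ _ (nbhs x) (nbhs_filter x)) => e e0.
have [d d0 ->] : exists2 d : R, 0 < d & e = d%:C%C.
  have /complex_realP[d ed] : e \is Num.real by exact: gtr0_real.
  by exists d => //; rewrite -ltcR -ed.
have k0 : 0 < `|k| + 1 by rewrite ltr_wpDl.
have dk : 0 < d / (`|k| + 1) by rewrite divr_gt0.
apply: filterS (nbhsx_ballx x _ dk) => y; rewrite ballEmdist/= => xy.
apply: le_lt_trans (ak x y) _; rewrite ltcR.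
apply: (@le_lt_trans _ _ ((`|k| + 1) * mdist x y)).
  rewrite ler_wpM2r ?mdist_ge0//.
  by apply: le_trans (ler_norm k) _; rewrite lerDl.
by rewrite mulrC -ltr_pdivlMr.
Qed.

Theorem proposition2p5 (R : realType) (X : metricType R)
  (Xcompact : compact [set: X])
  (B : set (X * X))
  (Boffdiag : B `<=` ~` diagonal)
  (Bsym : forall y y' : X, B (y, y') <-> B (y', y))
  (Bfin : forall t : R, 0 < t ->
     finite_set [set p | B p /\ t <= mdist p.1 p.2])
  (m : B -> nat)
  (msym : forall b : B, m (flipB Bsym b) = m b) :
  spectral_geometry (M_triple msym).
Proof.
(* The preceding results are applied with index set B, weights [len] and the inclusion [point] of B
   in X^2. *)
pose len (b : B) : R := mdist (val b).1 (val b).2.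
pose point (b : B) : X * X := val b.
have len_gt0 b : 0 < len b.
  rewrite /len mdist_gt0; apply/eqP => b12.
  exact: (Boffdiag _ (set_mem (valP b)) b12).
have len_fin t : 0 < t -> finite_set [set b | t <= len b].
  move=> /Bfin fin_t.
  have -> : [set b | t <= len b] =
      point @^-1` [set p | B p /\ t <= mdist p.1 p.2].
    by apply/seteqP; split=> [b tb|b []//]; split=> //; exact: set_mem (valP b).
  by apply: finite_preimage fin_t => x y _ _; exact: val_inj.
have len_flip b : len (flipB Bsym b) = len b by rewrite /len/= metric_sym.
have point_inj : injective point by exact: val_inj.
have B_countable := countable_pos_weights len_gt0 len_fin.
have dsE (x : l2 R m) b := M_dsE msym x b Xcompact.
have flipK := flipBK Bsym.
have XXcompact : compact [set: X * X] by rewrite -setXTT; exact: compact_setX.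
have XXaccessible : accessible_space (X * X)%type.
  by apply: accessible_prod; apply: hausdorff_accessible; exact: metric_hausdorff.
have [D DX] := compact_mdist_bounded Xcompact.
have cont_bounded (a : X * X -> R[i]) : continuous a -> bounded_family (a \o point).
  by move=> /(compact_complex_bounded XXcompact)[M aM]; exists M => b; exact: aM.
have lip_bounded (a : X -> R[i]) : lipschitz_fun a ->
    bounded_family (a \o (fst \o point)).
  by move=> /(lipschitz_bounded Xcompact)[M aM]; exists M => b; exact: aM.
split.
- exact: (mult_star_representation m lip_bounded).
- split.
  + exact: (ds_bounded flipK len_gt0 dsE (fun b => DX (val b).1 (val b).2)).
  + exact: (ds_injective flipK len_flip len_gt0 dsE).
  + exact: (ds_compact flipK len_gt0 dsE len_fin).
  + exact: (ds_self_adjoint flipK len_flip dsE).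
exists (fun a => mult (a \o point)), (@diag_measure R B m _ point).
split.
- split.
  + exact: (mult_star_representation m cont_bounded).
  + by move=> a _ xi.
  + exact: diag_spectral_measure.
  + move=> a ca; apply: diag_spectral_integral => //; exact: cont_bounded.
- move=> A _ x; apply: (ds_diag_measure dsE) => b.
  (* [flip] is an involution of X^2, so the flipped point lies in [A] exactly when the point lies in
     the image of [A]. *)
  apply/idP/idP => [/set_mem Ab|/set_mem[q Aq qb]]; apply/mem_set.
    by exists (flip (val b)) => //; rewrite /point; case: (val b).
  by rewrite /point/= -[\val b]qb; case: q Aq {qb}.
(* The length of the point [b] attached to the eigenvalue serves as [r]. *)
- move=> lambda /(eigenvalue_length flipK len_flip dsE)[b lb]; split.
    exact: l2_restrict_projector.
  rewrite /spectral_complement.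
  rewrite (largest_orthogonal_open flipK len_flip len_gt0 dsE (len_gt0 b) lb
    point XXaccessible len_fin).
  exact: (range_complement flipK len_flip len_gt0 dsE (len_gt0 b) lb point_inj).
- move=> lambda /(eigenvalue_length flipK len_flip dsE)[b lb] q.
  rewrite /spectral_complement.
  rewrite (largest_orthogonal_open flipK len_flip len_gt0 dsE (len_gt0 b) lb
    point XXaccessible len_fin) setCK => -[c [lc _] <-].
  rewrite -[mdist _ _]/(len c) lc.
  have l0 : 0 <= (len b)%:C%C by rewrite ler0c ltW.
  (* Equal squares give [lambda] equal to the length of [b] up to sign, hence the same modulus. *)
  by move/eqP: lb; rewrite eqf_sqr => /orP[]/eqP ->; rewrite ?normrN ger0_norm.
Qed.
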